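(* Let $P$ be an unknown Gaussian distribution on $\mathbb{R}^d$ such that there exists a directed tree $T^*$ for which $P$ is $T^*$-structured, i.e. $P=P_{T^*}$. Suppose we are given $n$ i.i.d. samples from $P$. For any sufficiently small $\varepsilon>0$, if $n=o(d/\varepsilon)$, then no algorithm returns a directed tree $\widehat T$ such that $D_{\mathrm{KL}}(P\,\|\,P_{\widehat T})\le\varepsilon$ with probability at least $2/3$ (for every such $P$).
   Context: A directed tree on $[d]$ is a directed graph with a root $u$ such that for every other node $v$ there is exactly one directed path from $u$ to $v$. For a directed tree $T$, a Gaussian distribution $Q=\mathcal{N}(0,\Sigma)$ is $T$-structured if $Q(x)=\prod_{k}Q(x_k\mid x_{\mathrm{pa}_T(k)})$. For a distribution $P$, $P_T:=\arg\min_{Q\ \text{$T$-structured}}D_{\mathrm{KL}}(P\,\|\,Q)$. *)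

(* Defs.v *)
From HB Require Import structures.
From mathcomp Require Import all_boot all_order all_algebra.
From mathcomp Require Import all_classical all_reals all_analysis.

Set Implicit Arguments.
Unset Strict Implicit.
Unset Printing Implicit Defensive.

Import Order.TTheory GRing.Theory Num.Theory.
Local Open Scope ring_scope.

Section GaussTree.
Variable R : realType.

(* Iterated Lebesgue integral over R^m of f : seq R -> \bar R
   (the argument list collects the m coordinates, in order).
   By Tonelli/Fubini this is the integral w.r.t. Lebesgue measure on R^m. *)
Fixpoint iint (m : nat) (f : seq R -> \bar R) : \bar R :=
  match m with
  | 0 => f [::]
  | m'.+1 => (\int[@lebesgue_measure R]_z iint m' (fun s => f (z :: s)))%E
  end.

Definition vec_of (m : nat) (s : seq R) : 'rV[R]_m := \row_(j < m) nth 0 s j.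

Definition posdef (m : nat) (S : 'M[R]_m) : Prop :=
  S^T = S /\ forall x : 'rV[R]_m, x != 0 -> 0 < (x *m S *m x^T) 0 0.

Definition gdens (m : nat) (S : 'M[R]_m) (x : 'rV[R]_m) : R :=
  (Num.sqrt ((pi *+ 2) ^+ m * \det S))^-1
  * expR (- ((x *m invmx S *m x^T) 0 0) / 2).

Definition KL (d : nat) (S1 S2 : 'M[R]_d) : \bar R :=
  iint d (fun s => let x := vec_of d s in
    (gdens S1 x * ln (gdens S1 x / gdens S2 x))%:E).

Definition dgraph (d : nat) := {set 'I_d * 'I_d}.

Definition erel (d : nat) (E : dgraph d) : rel 'I_d := fun a b => (a, b) \in E.

Definition is_root (d : nat) (E : dgraph d) (u : 'I_d) : Prop :=
  forall v : 'I_d, v != u ->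
    exists! p : seq 'I_d, path (erel E) u p /\ last u p = v.

Definition is_dtree (d : nat) (E : dgraph d) : Prop :=
  exists u : 'I_d, is_root E u.

Definition cov1 (d : nat) (S : 'M[R]_d) (k : 'I_d) : 'M[R]_1 :=
  \matrix_(i < 1, j < 1) S k k.
Definition cov2 (d : nat) (S : 'M[R]_d) (a b : 'I_d) : 'M[R]_2 :=
  \matrix_(i < 2, j < 2)
     S (if i == 0 :> nat then a else b) (if j == 0 :> nat then a else b).
Definition pt1 (d : nat) (x : 'rV[R]_d) (k : 'I_d) : 'rV[R]_1 :=
  \row_(j < 1) x 0 k.
Definition pt2 (d : nat) (x : 'rV[R]_d) (a b : 'I_d) : 'rV[R]_2 :=
  \row_(j < 2) x 0 (if j == 0 :> nat then a else b).

(* N(0,S) is T-structured: Q(x) = Q(x_u) * prod_{(j,k) in T} Q(x_k | x_j),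
   u the root, Q(x_k | x_j) = Q(x_j, x_k) / Q(x_j) (Gaussian marginals) *)
Definition tstructured (d : nat) (E : dgraph d) (S : 'M[R]_d) : Prop :=
  exists u : 'I_d, is_root E u /\
    forall x : 'rV[R]_d,
      gdens S x = gdens (cov1 S u) (pt1 x u) *
        \prod_(e in E) (gdens (cov2 S e.1 e.2) (pt2 x e.1 e.2)
                         / gdens (cov1 S e.1) (pt1 x e.1)).

(* Q = N(0,S') is (a version of) P_T = argmin_{Q T-structured} D(P || Q),
   where P = N(0,S) *)
Definition is_proj (d : nat) (S : 'M[R]_d) (E : dgraph d) (S' : 'M[R]_d) : Prop :=
  posdef S' /\ tstructured E S' /\
  forall S'' : 'M[R]_d, posdef S'' -> tstructured E S'' ->
    (KL S S' <= KL S S'')%E.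

Definition good (d : nat) (S : 'M[R]_d) (eps : R) (E : dgraph d) : Prop :=
  exists S' : 'M[R]_d, is_proj S E S' /\ (KL S S' <= eps%:E)%E.

Definition samples (n d : nat) := n.-tuple (d.-tuple R).

Definition samples_of (n d : nat) (s : seq R) : samples n d :=
  [tuple [tuple nth 0 s (i * d + j) | j < d] | i < n].

Definition rowv (d : nat) (x : d.-tuple R) : 'rV[R]_d := \row_(j < d) tnth x j.

(* A (possibly randomized) algorithm: given the samples X, A X E is the
   probability of outputting the graph E; it outputs only directed trees
   and is measurable in the samples. *)
Definition algorithm (n d : nat) (A : samples n d -> dgraph d -> R) : Prop :=
  [/\ forall X E, 0 <= A X E,
      forall X, \sum_(E : dgraph d) A X E = 1,
      forall X E, ~ is_dtree E -> A X E = 0 &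
      forall E, measurable_fun setT (fun X => A X E)].

Definition success (n d : nat) (S : 'M[R]_d) (eps : R)
    (A : samples n d -> dgraph d -> R) : \bar R :=
  iint (n * d) (fun s => let X := samples_of n d s in
    ((\prod_(i < n) gdens S (rowv (tnth X i)))
     * \sum_(E : dgraph d | `[< good S eps E >]) A X E)%:E).

End GaussTree.

(* Main.v *)
Require Import Defs.
From HB Require Import structures.
From mathcomp Require Import all_boot all_order all_algebra.
From mathcomp Require Import all_classical all_reals all_analysis.
From mathcomp Require Import measurable_realfun ring lra.
Import Order.TTheory GRing.Theory Num.Theory.
Local Open Scope ring_scope.

(* Assouad's method. Take two independent standard Gaussian hubs and let every other
   coordinate be r times one of the hubs plus standard noise, one bit per leaf, with
   r^2 = 160 eps / d. If S' is structured over a tree with parent map pa, then by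
   a / s + ln s >= 1 + ln a the divergence 2 KL(S, S') is at least the sum over j of
   ln Var(x_j - beta_j x_(pa j)); a leaf not attached to its own hub contributes at least
   r^2 / 4 and each hub loses at most r^2. Hence an eps-good tree identifies all but a tenth
   of the bits. On the other hand, the laws of n samples before and after flipping one bit
   have Hellinger affinity at least 1 - n r^2 / 4 >= 99 / 100, and a tree attaches a leaf to
   at most one hub, so on average over the bits no algorithm identifies much more than half
   of them. *)

Set Implicit Arguments.
Unset Strict Implicit.
Unset Printing Implicit Defensive.

(** * One-dimensional Gaussian integrals *)

(** The scale of [r] balances two effects: a wrong leaf costs order [r ^+ 2] in divergence, hence
    order [eps] over [d] leaves, while one sample carries information of the same order [r ^+ 2]
    about each bit, so [n * r ^+ 2] has to stay small. The orientation of an edge cannot be read off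
    a Gaussian law, so a good tree may well point from a leaf to its hub. Only edges from hub to
    leaf count as correct; this is harmless because each of the two hubs has at most one parent, and
    such reversed edges are what the loss of [r ^+ 2] per hub pays for. Instead of passing through
    total variation and Cauchy-Schwarz, the larger of two likelihoods is bounded, pointwise in the
    sample, by a linear expression in both and their geometric mean. Two integration calculi
    coexist: the integrand of the divergence is signed, so its value comes from explicit witnesses
    of integrability at every stage; the output probabilities are merely measurable and nonnegative,
    so they go through Tonelli. *)

Definition phi (R : realType) (x : R) : R :=
  (Num.sqrt (pi *+ 2))^-1 * expR (- x ^+ 2 / 2).

Definition ndens (R : realType) (s m x : R) : R :=
  (Num.sqrt (pi *+ 2 * s))^-1 * expR (- (x - m) ^+ 2 / (s * 2)).

(** Integrability is recorded together with the value, so that linearity holds for signed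
    functions. *)
Definition integral_is (R : realType) (f : R -> R) (v : R) :=
  integrable (@lebesgue_measure R) setT (EFin \o f) /\
  (\int[@lebesgue_measure R]_x (f x)%:E = v%:E)%E.

Section OneDim.
Variable R : realType.
Implicit Types (f g : R -> R) (v w x m : R).

Lemma phi_gt0 x : 0 < phi x.
Proof. by rewrite mulr_gt0 ?expR_gt0// invr_gt0 sqrtr_gt0 mulrn_wgt0// pi_gt0. Qed.

Lemma measurable_phi : measurable_fun setT (@phi R).
Proof.
apply: measurable_funM => //; apply: measurableT_comp => //.
by apply: measurable_funM => //; apply: measurable_funN; exact: measurable_funX.
Qed.

Lemma ndensE s m x : 0 < s -> ndens s m x = normal_pdf m (Num.sqrt s) x.
Proof.
move=> s0; rewrite normal_pdfE ?gt_eqF ?sqrtr_gt0//.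
rewrite /ndens /normal_peak /normal_fun sqr_sqrtr ?ltW//.
by congr (((Num.sqrt _)^-1) * expR (_ / _)); ring.
Qed.

Lemma phi_ndens m x : phi (x - m) = ndens 1 m x.
Proof. by rewrite /phi /ndens mulr1 mul1r. Qed.

Lemma integral_is_ext f g v : f =1 g -> integral_is f v -> integral_is g v.
Proof. by move=> /funext ->. Qed.

Lemma integral_isD f g v w : integral_is f v -> integral_is g w ->
  integral_is (fun x => f x + g x) (v + w).
Proof.
move=> [fi fv] [gi gw]; split.
  have -> : EFin \o (fun x => f x + g x) = ((EFin \o f) \+ (EFin \o g))%E.
    by apply/funext => x /=; rewrite EFinD.
  exact: integrableD.
by under eq_integral do rewrite EFinD; rewrite integralD//= fv gw.
Qed.

Lemma integral_isZ (c : R) f v : integral_is f v ->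
  integral_is (fun x => c * f x) (c * v).
Proof.
move=> [fi fv]; split.
  have -> : EFin \o (fun x => c * f x) = (fun x => c%:E * (EFin \o f) x)%E.
    by apply/funext => x /=; rewrite EFinM.
  exact: integrableZl.
by under eq_integral do rewrite EFinM; rewrite integralZl//= fv.
Qed.

Lemma integral_is_le f g v w : (forall x, f x <= g x) ->
  integral_is f v -> integral_is g w -> v <= w.
Proof.
move=> fg [fi fv] [gi gw]; rewrite -lee_fin -fv -gw.
by apply: le_integral => // x _; rewrite lee_fin.
Qed.

Lemma integral_is_ndens s m : 0 < s -> integral_is (ndens s m) 1.
Proof.
move=> s0; have -> : ndens s m = normal_pdf m (Num.sqrt s).
  by apply/funext => x; exact: ndensE.
by split; [exact: integrable_normal_pdf | rewrite integral_normal_pdf].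
Qed.

Lemma integral_is_phi m : integral_is (fun x => phi (x - m)) 1.
Proof.
apply: (integral_is_ext (f := ndens 1 m)) => [x|]; first by rewrite phi_ndens.
exact: integral_is_ndens.
Qed.

Lemma ex_integral_is f : integrable (@lebesgue_measure R) setT (EFin \o f) ->
  exists v, integral_is f v.
Proof.
move=> fi; exists (fine (\int[@lebesgue_measure R]_x (f x)%:E)%E); split=> //.
by rewrite fineK//; exact: integrable_fin_num.
Qed.

Lemma ex_integral_is_le f g w : measurable_fun setT f ->
  (forall x, `|f x| <= g x) -> integral_is g w -> exists v, integral_is f v.
Proof.
move=> mf fg [gi _]; apply: ex_integral_is; apply: le_integrable gi => //.
  exact/measurable_EFinP.
by move=> x _; rewrite /= lee_fin (le_trans (fg x))// ler_norm.
Qed.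

(** The exponential factor changes the precision from 1 to [w ^- 2]; the prefactor [w] is the ratio
    of the normalizing constants. *)
Lemma phi_scale w m x : 0 < w ->
  phi (x - m) * expR (- (w ^- 2 - 1) * ((x - m) ^+ 2 / 2))
  = w * ndens (w ^+ 2) m x.
Proof.
have p0 : 0 <= pi *+ 2 :> R by rewrite mulrn_wge0// pi_ge0.
move=> w0; rewrite /phi /ndens -mulrA -expRD (sqrtrM _ p0).
rewrite sqrtr_sqr gtr0_norm// (invfM (Num.sqrt _)).
have -> : - (x - m) ^+ 2 / 2 + - (w ^- 2 - 1) * ((x - m) ^+ 2 / 2) =
   - (x - m) ^+ 2 / (w ^+ 2 * 2) by field; rewrite gt_eqF.
by rewrite [RHS]mulrA [w * _]mulrCA divff ?gt_eqF// mulr1.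
Qed.

(** Completing the square: an exponential tilt of a normal density shifts its mean. *)
Lemma phi_tilt t m x :
  phi (x - m) * expR (t * (x - m)) = expR (t ^+ 2 / 2) * phi (x - (m + t)).
Proof.
rewrite /phi -[LHS]mulrA -expRD [RHS]mulrCA -expRD.
by congr (_ * expR _); field.
Qed.

(* Convexity of exp bounds the integral of a rescaled Gaussian from below by its
   first-order expansion in the precision; both signs of the perturbation pin down
   the second moment. *)
Lemma phi_moment2 m : integral_is (fun x => phi (x - m) * (x - m) ^+ 2) 1.
Proof.
have mx : measurable_fun setT (fun x => phi (x - m) * (x - m) ^+ 2).
  apply: measurable_funM; first by apply: (measurableT_comp measurable_phi); exact: measurable_funB.
  by apply: measurable_funX; exact: measurable_funB.
have Q w : 0 < w -> integral_is (fun x => phi (x - m) *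
    expR (- (w ^- 2 - 1) * ((x - m) ^+ 2 / 2))) w.
  move=> w0.
  have := integral_isZ w (integral_is_ndens m (exprn_gt0 2 w0)).
  by rewrite mulr1; apply: integral_is_ext => x; rewrite phi_scale.
have [v Iv] : exists v, integral_is (fun x => phi (x - m) * (x - m) ^+ 2) v.
  (* At [w = 2] the exponent is [3/8] times the square, so [8/3] times this Gaussian integrand
     dominates the second moment. *)
  apply: (ex_integral_is_le mx _ (integral_isZ (8/3) (Q 2 (ltr0Sn R 1)))) => x.
  rewrite ger0_norm ?(mulr_ge0 (ltW (phi_gt0 _)) (sqr_ge0 _))//.
  rewrite [leRHS]mulrCA ler_pM2l ?phi_gt0//.
  have := expR_ge1Dx (- (2 ^- 2 - 1) * ((x - m) ^+ 2 / 2)); lra.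
have key w : 0 < w -> 1 - (w ^- 2 - 1) / 2 * v <= w.
  move=> w0; rewrite -mulNr.
  apply: (integral_is_le _ (integral_isD (integral_is_phi m)
    (integral_isZ (- ((w ^- 2 - 1) / 2)) Iv)) (Q w w0)) => x.
  rewrite [X in _ + X]mulrCA -[X in X + _]mulr1 -mulrDr ler_pM2l ?phi_gt0//.
  by apply: le_trans (expR_ge1Dx _); rewrite lerD2l; lra.
(* Clearing denominators exposes the factor [w - 1], which changes sign at 1: values of [w] just
   below 1 bound [v] from below, values just above bound it from above, and both bounds tend to
   1. *)
have key2 w : 0 < w -> 0 <= (w - 1) * (2 * w ^+ 2 - (w + 1) * v).
  move=> w0; have := key w w0.
  rewrite -(ler_pM2r (_ : 0 < 2 * w ^+ 2)) ?mulr_gt0 ?exprn_gt0//.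
  have -> : (1 - (w ^- 2 - 1) / 2 * v) * (2 * w ^+ 2) = 2 * w ^+ 2 - (1 - w ^+ 2) * v.
    by field; rewrite gt_eqF.
  by move=> h; nra.
suff -> : 1 = v by [].
apply/eqP; rewrite eq_le; apply/andP; split; apply/ler_addgt0Pr => e e0.
  pose d := Num.min (e / 2) (1 / 2).
  have d0 : 0 < d by rewrite lt_min; apply/andP; split; lra.
  have de : d <= e / 2 by rewrite ge_min lexx.
  have dh : d <= 1 / 2 by rewrite ge_min lexx orbT.
  have w0 : 0 < 1 - d by lra.
  have := key2 _ w0; have -> : 1 - d - 1 = - d by ring.
  rewrite mulNr oppr_ge0 pmulr_rle0// => h.
  suff : 1 - 2 * d <= v by lra.
  by rewrite -(ler_pM2l (_ : 0 < 2 - d)); [nra | lra].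
have w0 : 0 < 1 + e / 2 by lra.
have := key2 _ w0; have -> : 1 + e / 2 - 1 = e / 2 by ring.
rewrite pmulr_rge0 ?divr_gt0// => h.
by rewrite -(ler_pM2l (_ : 0 < 2 + e / 2)); [nra | lra].
Qed.

(** By convexity of exp, integrating the tilt by [t] gives [t * v <= expR (t ^+ 2 / 2) - 1], which
    is of second order in [t]; small [t] of both signs force [v = 0]. *)
Lemma phi_moment1 m : integral_is (fun x => phi (x - m) * (x - m)) 0.
Proof.
have mx : measurable_fun setT (fun x => phi (x - m) * (x - m)).
  apply: measurable_funM; last by exact: measurable_funB.
  by apply: (measurableT_comp measurable_phi); exact: measurable_funB.
have [v Iv] : exists v, integral_is (fun x => phi (x - m) * (x - m)) v.
  apply: (ex_integral_is_le mx _ (integral_isD (integral_is_phi m) (phi_moment2 m))) => x.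
  have -> : phi (x - m) + phi (x - m) * (x - m) ^+ 2 = phi (x - m) * (1 + (x - m) ^+ 2).
    by ring.
  rewrite normrM (gtr0_norm (phi_gt0 _)) ler_pM2l ?phi_gt0//.
  by rewrite -[(x - m) ^+ 2]real_normK ?num_real//; nra.
have key t : 1 + t * v <= expR (t ^+ 2 / 2).
  have Q : integral_is (fun x => phi (x - m) * expR (t * (x - m))) (expR (t ^+ 2 / 2)).
    have := integral_isZ (expR (t ^+ 2 / 2)) (integral_is_phi (m + t)).
    by rewrite mulr1; apply: integral_is_ext => x; rewrite phi_tilt.
  apply: (integral_is_le _ (integral_isD (integral_is_phi m) (integral_isZ t Iv)) Q) => x.
  rewrite [X in _ + X]mulrCA -[X in X + _]mulr1 -mulrDr ler_pM2l ?phi_gt0//.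
  exact: expR_ge1Dx.
have key2 t : t ^+ 2 <= 1 -> t * v <= t ^+ 2.
  move=> t1; have := key t; have := expR_ge1Dx (- (t ^+ 2 / 2)).
  have := expRxMexpNx_1 (t ^+ 2 / 2).
  have := expR_gt0 (t ^+ 2 / 2); have := sqr_ge0 t.
  set E := expR (t ^+ 2 / 2); set E' := expR (- _); move: t1; set q := t ^+ 2.
  move=> q1 q0 E0 EE' hE' h.
  suff : E <= 1 + q by lra.
  have hq : 0 < 1 - q / 2 by lra.
  rewrite -(ler_pM2r hq); have : E * (1 - q / 2) <= E * E' by rewrite ler_pM2l//; lra.
  by rewrite EE'; nra.
suff -> : 0 = v by [].
apply/eqP; rewrite eq_le; apply/andP; split; apply/ler_addgt0Pr => e e0;
  pose d := Num.min e (1/2);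
  have d0 : 0 < d by [rewrite lt_min e0/=; lra];
  have de : d <= e by [rewrite ge_min lexx];
  have dh : d <= 1/2 by [rewrite ge_min lexx orbT].
- have := key2 (- d); rewrite sqrrN => /(_ ltac:(nra)) => h; nra.
- have := key2 d => /(_ ltac:(nra)) => h; nra.
Qed.

(** The shape of an affine form squared plus a constant survives integrating out one coordinate,
    which is what makes the induction for many coordinates close. *)
Lemma phi_quadratic m (c l D : R) :
  integral_is (fun z => phi (z - m) * ((c + l * z) ^+ 2 + D))
              ((c + l * m) ^+ 2 + l ^+ 2 + D).
Proof.
have := integral_isD (integral_isD (integral_isZ ((c + l * m) ^+ 2 + D) (integral_is_phi m))
  (integral_isZ (2 * l * (c + l * m)) (phi_moment1 m))) (integral_isZ (l ^+ 2) (phi_moment2 m)).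
rewrite !mulr1 mulr0 addr0 addrAC; apply: integral_is_ext => z; ring.
Qed.

End OneDim.

(** * Iterated integrals of Gaussian densities *)

(* Explicit witness that an iterated integral converges absolutely at every stage,
   with value [v]; unlike [iint] on signed integrands it is linear unconditionally. *)
Fixpoint iint_is (R : realType) (m : nat) (f : seq R -> R) (v : R) : Prop :=
  match m with
  | 0 => f [::] = v
  | m'.+1 => exists2 g, (forall z, iint_is m' (fun s => f (z :: s)) (g z)) &
                        integral_is g v
  end.

Section Iterated.
Variable R : realType.
Implicit Types (f g : seq R -> R) (v w c : R).

Lemma iint_isE m f v : iint_is m f v -> iint m (fun s => (f s)%:E) = v%:E.
Proof.
elim: m f v => [|m IH] f v /=; first by move=> ->.
by move=> [g fg [_ <-]]; apply: eq_integral => z _; exact: IH.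
Qed.

Lemma iint_is_ext m f g v : (forall s, size s = m -> f s = g s) ->
  iint_is m f v -> iint_is m g v.
Proof.
elim: m f g v => [|m IH] f g v fg /=; first by rewrite fg.
by move=> [h fh hv]; exists h => // z; apply: IH (fh z) => s sm; rewrite fg//= sm.
Qed.

Lemma iint_isD m f g v w : iint_is m f v -> iint_is m g w ->
  iint_is m (fun s => f s + g s) (v + w).
Proof.
elim: m f g v w => [|m IH] f g v w /=; first by move=> -> ->.
move=> [h fh hv] [k gk kw]; exists (fun z => h z + k z); last exact: integral_isD.
by move=> z; exact: IH.
Qed.

Lemma iint_isZ m c f v : iint_is m f v -> iint_is m (fun s => c * f s) (c * v).
Proof.
elim: m f v => [|m IH] f v /=; first by move=> ->.
move=> [h fh hv]; exists (fun z => c * h z); last exact: integral_isZ.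
by move=> z; exact: IH.
Qed.

Lemma iint_is0 m : iint_is m (fun=> 0 : R) 0.
Proof.
elim: m => [//|m IH] /=; exists (fun=> 0) => //.
have := integral_isZ 0 (integral_is_phi (0 : R)); rewrite mul0r.
by apply: integral_is_ext => z; rewrite mul0r.
Qed.

Lemma iint_is_sum m (I : Type) (r : seq I) (P : pred I) (F : I -> seq R -> R) (V : I -> R) :
  (forall i, P i -> iint_is m (F i) (V i)) ->
  iint_is m (fun s => \sum_(i <- r | P i) F i s) (\sum_(i <- r | P i) V i).
Proof.
move=> FV; elim: r => [|i r IH].
  by rewrite big_nil; apply: iint_is_ext (iint_is0 m) => s _; rewrite big_nil.
rewrite big_cons; case: ifP => Pi.
  by apply: iint_is_ext (iint_isD (FV i Pi) IH) => s _; rewrite big_cons Pi.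
by apply: iint_is_ext IH => s _; rewrite big_cons Pi.
Qed.

Lemma iint_is_cat m k f g v : (forall s, size s = m -> iint_is k (fun t => f (s ++ t)) (g s)) ->
  iint_is m g v -> iint_is (m + k) f v.
Proof.
elim: m f g v => [|m IH] f g v fg /=.
  by move=> <-; exact: (fg [::]).
move=> [h gh hv]; exists h => // z.
by apply: (IH _ (fun s => g (z :: s))) => // s sm; apply: (fg (z :: s)); rewrite /= sm.
Qed.

(** Consecutive blocks of length [d] are the layout in which [samples_of] reads the coordinates. *)
Lemma iint_is_prodn d f v n : iint_is d f v ->
  iint_is (n * d) (fun s => \prod_(i < n) f (take d (drop (i * d) s))) (v ^+ n).
Proof.
move=> fv; elim: n => [|n IH]; first by rewrite /= big_ord0.
rewrite mulSn exprS; apply: (iint_is_cat (g := fun s => v ^+ n * f s)); last first.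
  by rewrite mulrC; exact: iint_isZ.
move=> s sd; rewrite mulrC; apply: iint_is_ext (iint_isZ (f s) IH) => t _.
rewrite big_ord_recl mul0n drop0 -[in X in take X (s ++ t)]sd take_size_cat//.
by congr (_ * _); apply: eq_bigr => i _; rewrite lift0 mulSn drop_cat sd ltnNge leq_addr/= addKn.
Qed.

(** The constant [c] is general because the induction absorbs the outermost coordinate into it. The
    constant [D] lets the same formula yield the total mass, at [c = 0], [l = 0], [D = 1]. *)
Lemma iint_is_gauss k (m l : nat -> R) c D :
  iint_is k (fun s => \prod_(i < k) phi (nth 0 s i - m i) *
                      ((c + \sum_(i < k) l i * nth 0 s i) ^+ 2 + D))
    ((c + \sum_(i < k) l i * m i) ^+ 2 + \sum_(i < k) l i ^+ 2 + D).
Proof.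
elim: k m l c D => [|k IH] m l c D /=; first by rewrite !big_ord0 mul1r !addr0.
exists (fun z => phi (z - m 0) * ((c + \sum_(i < k) l i.+1 * m i.+1 + l 0 * z) ^+ 2
   + (\sum_(i < k) l i.+1 ^+ 2 + D))).
  move=> z; rewrite addrAC addrA.
  apply: iint_is_ext (iint_isZ (phi (z - m 0)) (IH (m \o S) (l \o S) (c + l 0 * z) D)).
  by move=> s _; rewrite !big_ord_recl /= [LHS]mulrA addrA.
have := phi_quadratic (m 0) (c + \sum_(i < k) l i.+1 * m i.+1) (l 0) (\sum_(i < k) l i.+1 ^+ 2 + D).
by rewrite !big_ord_recl /= !addrA (addrAC c).
Qed.

(* Hubs [x_0, x_1] and leaves [x_(i+2) = r * x_(b i) + N(0,1)]; the Boolean [b i] is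
   coerced to the index 0 or 1. *)
Definition hub_dens k (r : R) (b : nat -> bool) (s : seq R) : R :=
  phi (nth 0 s 0) * phi (nth 0 s 1) *
  \prod_(i < k) phi (nth 0 s i.+2 - r * nth 0 s (b i)).

Lemma phi_quadratic0 c (l D : R) :
  integral_is (fun z => phi z * ((c + l * z) ^+ 2 + D)) (c ^+ 2 + l ^+ 2 + D).
Proof.
have := phi_quadratic 0 c l D; rewrite mulr0 addr0.
by apply: integral_is_ext => z; rewrite subr0.
Qed.

(** Given the hubs, the leaves are independent with unit variance. Integrating them out leaves their
    squared coefficients as a constant and adds [r] times the coefficients of the leaves of each hub
    to that hub; two standard normals remain. *)
Lemma iint_is_hub_dens k r b (c0 c1 : R) (l : nat -> R) D :
  iint_is k.+2 (fun s => hub_dens k r b s *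
     ((c0 * nth 0 s 0 + c1 * nth 0 s 1 + \sum_(i < k) l i * nth 0 s i.+2) ^+ 2 + D))
   ((c0 + r * \sum_(i < k) l i *+ ~~ b i) ^+ 2 + (c1 + r * \sum_(i < k) l i *+ b i) ^+ 2
     + \sum_(i < k) l i ^+ 2 + D).
Proof.
set L0 := \sum_(i < k) l i *+ ~~ b i; set L1 := \sum_(i < k) l i *+ b i.
set Q := \sum_(i < k) l i ^+ 2.
exists (fun x => phi x * ((c0 + r * L0) ^+ 2 * x ^+ 2 + (c1 + r * L1) ^+ 2 + Q + D)); last first.
  have := phi_quadratic0 0 (c0 + r * L0) ((c1 + r * L1) ^+ 2 + Q + D).
  rewrite expr0n add0r !addrA; apply: integral_is_ext => z.
  by rewrite add0r exprMn !addrA.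
move=> x.
exists (fun y => phi x * (phi y * (((c0 + r * L0) * x + (c1 + r * L1) * y) ^+ 2 + (Q + D)))).
  move=> y; have := iint_is_gauss k (fun i => r * (if b i then y else x)) l (c0 * x + c1 * y) D.
  move=> /(iint_isZ (phi x * phi y)).
  have -> : \sum_(i < k) l i * (r * (if b i then y else x)) = r * L0 * x + r * L1 * y.
    rewrite /L0 /L1 !mulr_sumr !mulr_suml -big_split /=; apply: eq_bigr => i _.
    by case: (b i) => /=; rewrite ?mulr0n ?mulr1n; ring.
  rewrite -mulrA; have -> : c0 * x + c1 * y + (r * L0 * x + r * L1 * y) =
     (c0 + r * L0) * x + (c1 + r * L1) * y by ring.
  rewrite -[_ + Q + D]addrA; apply: iint_is_ext => s _.
  rewrite /hub_dens /= mulrA; congr (_ * _ * _).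
  by apply: eq_bigr => i _; case: (b i).
rewrite -exprMn -!addrA.
by have := integral_isZ (phi x) (phi_quadratic0 ((c0 + r * L0) * x) (c1 + r * L1) (Q + D));
  rewrite !addrA.
Qed.

Lemma iint_is_hub_dens1 k r b : iint_is k.+2 (hub_dens k r b) 1.
Proof.
have := iint_is_hub_dens k r b 0 0 (fun=> 0) 1.
rewrite !big1 ?mulr0 ?addr0 ?expr0n ?add0r; try by move=> i _; rewrite ?mul0rn ?expr0n.
apply: iint_is_ext => s _.
by rewrite !mul0r !add0r big1 ?expr0n ?add0r ?mulr1// => i _; rewrite mul0r.
Qed.

(** For [b] and [b'] differing in one bit this is the geometric mean of the two densities, and its
    integral is their Hellinger affinity. At the flipped leaf the average of the two squares is the
    square about the midpoint of the two means plus a multiple of the squared distance of the hubs,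
    whence the last factor. *)
Definition hub_geomean k (r : R) (b b' : nat -> bool) (s : seq R) : R :=
  phi (nth 0 s 0) * phi (nth 0 s 1) *
  \prod_(i < k) phi (nth 0 s i.+2 - r * (nth 0 s (b i) + nth 0 s (b' i)) / 2) *
  expR (- (r ^+ 2 * (nth 0 s 0 - nth 0 s 1) ^+ 2) / 8).

Lemma hub_geomean_ge0 k r b b' s : 0 <= hub_geomean k r b b' s.
Proof.
rewrite /hub_geomean !mulr_ge0 ?expR_ge0 ?(ltW (phi_gt0 _))//.
by apply: prodr_ge0 => i _; rewrite ltW// phi_gt0.
Qed.

Lemma hub_geomeanE k r (b b' : nat -> bool) (j : 'I_k) s :
  (forall i : 'I_k, (b i == b' i) = (i != j)) ->
  hub_geomean k r b b' s ^+ 2 = hub_dens k r b s * hub_dens k r b' s.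
Proof.
move=> bb'; rewrite /hub_geomean /hub_dens.
rewrite (bigD1 j)//= [X in _ = _ * X * _](bigD1 j)//= [X in _ = _ * (_ * X)](bigD1 j)//=.
have bj : b' j = ~~ b j by have := bb' j; rewrite eqxx /=; case: (b j); case: (b' j).
have E (i : 'I_k) : i != j -> b' i = b i by move=> /[!(esym (bb' i))] /eqP.
under eq_bigr => i ij do rewrite E//.
under [X in _ = _ * (_ * (_ * X))]eq_bigr => i ij do rewrite E//.
rewrite bj.
have -> : \prod_(i < k | i != j) phi (nth 0 s i.+2 - r * (nth 0 s (b i) + nth 0 s (b i)) / 2)
  = \prod_(i < k | i != j) phi (nth 0 s i.+2 - r * nth 0 s (b i)).
  by apply: eq_bigr => i _; congr phi; field.
set P := \prod_(i < k | i != j) _; set y := nth 0 s j.+2.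
set x0 := nth 0 s 0; set x1 := nth 0 s 1.
have key : phi (y - r * (nth 0 s (b j) + nth 0 s (~~ b j)) / 2) ^+ 2 *
   expR (- (r ^+ 2 * (x0 - x1) ^+ 2) / 8) ^+ 2 =
   phi (y - r * nth 0 s (b j)) * phi (y - r * nth 0 s (~~ b j)).
  have K : expR (- (y - r * (nth 0 s (b j) + nth 0 s (~~ b j)) / 2) ^+ 2 / 2) ^+ 2 *
    expR (- (r ^+ 2 * (x0 - x1) ^+ 2) / 8) ^+ 2 =
    expR (- (y - r * nth 0 s (b j)) ^+ 2 / 2) * expR (- (y - r * nth 0 s (~~ b j)) ^+ 2 / 2).
    rewrite !expr2 -!expRD; congr expR.
    by case: (b j) => /=; rewrite -/x0 -/x1; field.
  by rewrite /phi exprMn -[LHS]mulrA K; ring.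
transitivity (phi x0 ^+ 2 * phi x1 ^+ 2 * P ^+ 2 *
  (phi (y - r * nth 0 s (b j)) * phi (y - r * nth 0 s (~~ b j)))).
  by rewrite -key; ring.
ring.
Qed.

(** Once the leaves are integrated out, the mean of [expR (- r ^+ 2 * (x - y) ^+ 2 / 8)] over
    independent standard normals [x], [y] remains. Since [x - y] has variance 2, this mean is the
    inverse square root of [1 + r ^+ 2 / 2]. *)
Lemma iint_is_hub_geomean k (r : R) b b' : r ^+ 2 <= 1 ->
  exists2 v, iint_is k.+2 (hub_geomean k r b b') v & 1 - r ^+ 2 / 4 <= v.
Proof.
move=> r1; have r0 := sqr_ge0 r.
(* In the Gaussian weight on the hubs, [v] is the precision of the second hub given the first, and
   [u / v] is the precision left for the first. *)
pose v : R := 1 + r ^+ 2 / 4; pose u : R := 1 + r ^+ 2 / 2.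
have v0 : 0 < v by rewrite /v; lra.
have u0 : 0 < u by rewrite /u; lra.
have pp : 0 < pi *+ 2 :> R by rewrite mulrn_wgt0// pi_gt0.
have sc (s x : R) : 0 < s -> expR (- x ^+ 2 / (s * 2)) * (Num.sqrt (pi *+ 2))^-1 =
    Num.sqrt s * ndens s 0 x.
  move=> s0; rewrite /ndens subr0 (sqrtrM _ (ltW pp)) (invfM (Num.sqrt _)).
  by field; rewrite !gt_eqF ?sqrtr_gt0.
exists (Num.sqrt (v / u) * Num.sqrt v^-1); last first.
  rewrite -sqrtrM; last by rewrite ltW// divr_gt0.
  have -> : v / u / v = u^-1 by field; rewrite !gt_eqF.
  have h : 0 <= 1 - r ^+ 2 / 4 by lra.
  rewrite -(ger0_norm h) -sqrtr_sqr ler_wsqrtr// -[X in _ <= X]mul1r ler_pdivlMr//.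
  rewrite /u; move: r0 r1; set q := r ^+ 2; nra.
exists (fun x => Num.sqrt v^-1 * (Num.sqrt (v / u) * ndens (v / u) 0 x)); last first.
  have := integral_isZ (Num.sqrt v^-1) (integral_isZ (Num.sqrt (v / u))
    (integral_is_ndens 0 (divr_gt0 v0 u0))).
  by rewrite mulr1 [X in integral_is _ X]mulrC.
move=> x; exists (fun y => expR (- x ^+ 2 / (v / u * 2)) * (Num.sqrt (pi *+ 2))^-1
     * (Num.sqrt v^-1 * ndens v^-1 (r ^+ 2 / 4 * x / v) y)); last first.
  have := integral_isZ (expR (- x ^+ 2 / (v / u * 2)) * (Num.sqrt (pi *+ 2))^-1)
    (integral_isZ (Num.sqrt v^-1) (integral_is_ndens (r ^+ 2 / 4 * x / v) (_ : 0 < v^-1))).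
  rewrite invr_gt0 => /(_ v0).
  by rewrite mulr1 sc ?divr_gt0// [X in integral_is _ X]mulrC.
move=> y.
have := iint_is_gauss k (fun i => r * (nth 0 [:: x; y] (b i) + nth 0 [:: x; y] (b' i)) / 2)
  (fun=> 0) 0 1.
rewrite !big1 ?mulr0 ?addr0 ?expr0n ?add0r; try by move=> i _; rewrite ?mul0r ?expr0n.
move=> /(iint_isZ (phi x * phi y * expR (- (r ^+ 2 * (x - y) ^+ 2) / 8))).
rewrite mulr1.
have K2 : phi x * phi y * expR (- (r ^+ 2 * (x - y) ^+ 2) / 8) =
  expR (- x ^+ 2 / (v / u * 2)) * (Num.sqrt (pi *+ 2))^-1
     * (Num.sqrt v^-1 * ndens v^-1 (r ^+ 2 / 4 * x / v) y).
  have := sc v^-1 (y - r ^+ 2 / 4 * x / v); rewrite invr_gt0 => /(_ v0).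
  rewrite {1}/ndens subr0 => <-.
  have K : expR (- x ^+ 2 / 2) * expR (- y ^+ 2 / 2) * expR (- (r ^+ 2 * (x - y) ^+ 2) / 8) =
      expR (- x ^+ 2 / (v / u * 2)) * expR (- (y - r ^+ 2 / 4 * x / v) ^+ 2 / (v^-1 * 2)).
    rewrite -!expRD; congr expR; move: v0 u0; rewrite /v /u => v0 u0; field.
    by rewrite !gt_eqF//; lra.
  rewrite /phi; set cc := (Num.sqrt _)^-1.
  rewrite -[LHS](_ : cc * cc * (expR (- x ^+ 2 / 2) * expR (- y ^+ 2 / 2) *
    expR (- (r ^+ 2 * (x - y) ^+ 2) / 8)) = _); last by ring.
  by rewrite K; ring.
rewrite K2; apply: iint_is_ext => s _; rewrite /hub_geomean /= -K2.
rewrite [in RHS]mulrAC; congr (_ * _).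
rewrite [\sum_(i < k) _]big1 ?add0r ?expr0n /= ?add0r ?mulr1; last by move=> i _; rewrite mul0r.
by apply: eq_bigr => i _; case: (b i); case: (b' i).
Qed.

End Iterated.

(** * Iterated integrals of nonnegative measurable functions *)

Section Tonelli.
Variable R : realType.
Local Open Scope ereal_scope.
Implicit Types (f g : seq R -> \bar R).

Lemma iint_ge0 m f : (forall s, 0 <= f s) -> 0 <= iint m f.
Proof.
elim: m f => [|m IH] f f0 /=; first exact: f0.
by apply: integral_ge0 => z _; apply: IH => s; exact: f0.
Qed.

(** The parameter space is arbitrary because the induction moves the outermost integration variable
    into the parameter, from [T] to [T * R]. *)
Lemma measurable_iint d (T : measurableType d) m (f : T -> seq R -> \bar R) :
  (forall t s, 0 <= f t s) ->
  measurable_fun setT (fun p : T * m.-tuple R => f p.1 p.2) ->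
  measurable_fun setT (fun t => iint m (f t)).
Proof.
elim: m d T f => [|m IH] d T f f0 mf /=.
  have mp : measurable_fun setT (fun t : T => (t, [tuple] : 0.-tuple R)).
    by apply: measurable_fun_pair => //; exact: measurable_id.
  exact: (measurableT_comp mf mp).
have mF : measurable_fun setT (fun p : T * R => iint m (fun s => f p.1 (p.2 :: s))).
  apply: (IH _ (T * R)%type (fun p s => f p.1 (p.2 :: s))) => //.
  have mp : measurable_fun setT (fun q : (T * R) * m.-tuple R =>
      (q.1.1, [tuple of q.1.2 :: q.2] : m.+1.-tuple R)).
    apply: measurable_fun_pair; first exact: (measurableT_comp measurable_fst).
    apply: (measurable_cons (f := fun q : (T * R) * m.-tuple R => q.1.2)) => //.
    exact: (measurableT_comp measurable_snd).
  exact: (measurableT_comp mf mp).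
have F0 p : 0 <= iint m (fun s => f p.1 (p.2 :: s)) by apply: iint_ge0.
exact: (measurable_fun_fubini_tonelli_F (m2 := @lebesgue_measure R) _ mF F0).
Qed.

(** Measurability concerns only lists of length [m], the ones at which [iint m] evaluates its
    integrand. *)
Definition measurable_seq m (D : measure_display) (U : measurableType D) (f : seq R -> U) :=
  measurable_fun setT (fun t : m.-tuple R => f t).

Lemma measurable_iint_cons m f : (forall s, 0 <= f s) -> measurable_seq m.+1 f ->
  measurable_fun setT (fun z => iint m (fun s => f (z :: s))).
Proof.
move=> f0 mf; apply: (@measurable_iint _ R m (fun z s => f (z :: s))) => //.
have mp : measurable_fun setT (fun q : R * m.-tuple R =>
   ([tuple of q.1 :: q.2] : m.+1.-tuple R)).
  by apply: (measurable_cons (f := fun q : R * m.-tuple R => q.1));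
     [exact: measurable_fst | exact: measurable_snd].
exact: (measurableT_comp mf mp).
Qed.

Lemma measurable_seq_cons m D (U : measurableType D) (f : seq R -> U) z :
  measurable_seq m.+1 f -> measurable_seq m (fun s => f (z :: s)).
Proof.
move=> mf; have mp : measurable_fun setT (fun q : m.-tuple R =>
   ([tuple of z :: q] : m.+1.-tuple R)).
  by apply: (measurable_cons (f := fun q : m.-tuple R => z));
     [exact: measurable_cst | exact: measurable_id].
exact: (measurableT_comp mf mp).
Qed.

Lemma iintD m f g : (forall s, 0 <= f s) -> (forall s, 0 <= g s) ->
  measurable_seq m f -> measurable_seq m g ->
  iint m (fun s => f s + g s) = iint m f + iint m g.
Proof.
elim: m f g => [//|m IH] f g f0 g0 mf mg /=.
rewrite -ge0_integralD//.
- by apply: eq_integral => z _; apply: IH => //; exact: measurable_seq_cons.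
- by move=> z _; apply: iint_ge0.
- exact: measurable_iint_cons.
- by move=> z _; apply: iint_ge0.
- exact: measurable_iint_cons.
Qed.

Lemma le_iint m f g : (forall s, 0 <= f s) ->
  (forall s, f s <= g s) -> measurable_seq m f -> measurable_seq m g ->
  iint m f <= iint m g.
Proof.
elim: m f g => [|m IH] f g f0 fg mf mg /=; first exact: fg.
have g0 s : 0 <= g s by exact: le_trans (f0 s) (fg s).
apply: ge0_le_integral => //.
- by move=> z _; apply: iint_ge0.
- exact: measurable_iint_cons.
- exact: measurable_iint_cons.
- by move=> z _; apply: IH => //; exact: measurable_seq_cons.
Qed.

Lemma iint_sum m (I : Type) (r : seq I) (f : I -> seq R -> \bar R) :
  (forall i s, 0 <= f i s) -> (forall i, measurable_seq m (f i)) ->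
  iint m (fun s => \sum_(i <- r) f i s) = \sum_(i <- r) iint m (f i).
Proof.
move=> f0 mf; elim: r => [|i r IH].
  have -> : (fun s => \sum_(i <- [::]) f i s) = (fun=> 0).
    by apply/funext => s; rewrite big_nil.
  rewrite big_nil; elim: m {mf} => [//|m IH] /=.
  by apply: integral0_eq => z _; exact: IH.
rewrite big_cons -IH -iintD//.
- by congr iint; apply/funext => s; rewrite big_cons.
- by move=> s; apply: sume_ge0.
- by apply: emeasurable_sum => j; exact: mf.
Qed.

Lemma iintZ m (c : R) (f : seq R -> \bar R) : (0 <= c)%R -> (forall s, 0 <= f s) ->
  measurable_seq m f -> iint m (fun s => c%:E * f s) = c%:E * iint m f.
Proof.
move=> c0; elim: m f => [//|m IH] f f0 mf /=.
rewrite -ge0_integralZl//.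
- by apply: eq_integral => z _; apply: IH => //; exact: measurable_seq_cons.
- exact: measurable_iint_cons.
- by move=> z _; apply: iint_ge0.
Qed.

Lemma measurable_seq_nth m i : measurable_seq m (fun s : seq R => nth 0%R s i).
Proof.
have [im|mi] := ltnP i m.
  apply: eq_measurable_fun (measurable_tnth (Ordinal im)) => s _.
  by rewrite (tnth_nth 0%R).
have m0 : measurable_fun setT (fun _ : m.-tuple R => 0%R : R) by exact: measurable_cst.
by apply: eq_measurable_fun m0 => s _; rewrite nth_default// size_tuple.
Qed.

Lemma measurable_samples_of n d :
  measurable_seq (n * d)%N (fun s : seq R => samples_of n d s).
Proof.
apply/measurable_fun_tnthP => i; apply/measurable_fun_tnthP => j.
have := @measurable_seq_nth (n * d)%N (i * d + j)%N; rewrite /measurable_seq => mij.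
apply: eq_measurable_fun mij => s _ /=.
by rewrite !tnth_mktuple.
Qed.

End Tonelli.

(** * Arborescences *)

Section Arborescence.

(** In [is_root] the uniqueness ranges over all walks, repeated nodes included. An edge into the
    root or a loop at another node would therefore produce a second, longer walk, and two parents of
    one node would produce two walks with different nodes before the last. *)
Lemma is_root_parent d (E : dgraph d) (u : 'I_d) : (1 < d)%N -> is_root E u ->
  exists pa : 'I_d -> 'I_d, (forall k, pa k != k) /\
    E = [set (pa k, k) | k in [set~ u]].
Proof.
move=> d1 ru.
have [v0 v0u] : exists v : 'I_d, v != u.
  apply/existsP; rewrite -negb_forall; apply/negP => /forallP allu.
  have : (#|'I_d| <= #|[set u]|)%N.
    by apply: subset_leq_card; apply/fintype.subsetP => x _; rewrite inE; exact: allu.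
  by rewrite card_ord cards1 leqNgt d1.
have reach j : exists2 p, path (erel E) u p & last u p = j.
  have [->|/ru [p [[up pj] _]]] := eqVneq j u; first by exists [::].
  by exists p.
have walk_uniq k p q : k != u -> path (erel E) u p -> path (erel E) u q ->
    last u p = k -> last u q = k -> p = q.
  move=> /ru [s [_ us]] up uq pk qk.
  by rewrite -(us p (conj up pk)) (us q (conj uq qk)).
have root_in j : (j, u) \in E -> False.
  move=> ju; have [p up pj] := reach j; have [q uq qv] := reach v0.
  have := @walk_uniq v0 q (rcons p u ++ q) v0u uq.
  rewrite cat_path rcons_path last_cat last_rcons up pj qv uq /erel ju /= => /(_ erefl erefl erefl).
  by move/(congr1 size)/eqP; rewrite size_cat size_rcons addSn -[X in X == _]add0n -addSn eqn_add2r.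
(* At the root the parent is a dummy value; taking [v0 != u] makes [pa k != k] hold everywhere. *)
have ex_par k : exists j, (j != k) /\ (forall i, k != u -> (i, k) \in E <-> i = j).
  have [->|ku] := eqVneq k u; first by exists v0; split => // i /eqP.
  have [p up pk] := reach k; case/lastP: p up pk => [_ uk|p x].
    by move: ku; rewrite -uk /= eqxx.
  rewrite rcons_path last_rcons => /andP[up jx] xk; move: jx; rewrite {}xk /erel => jk.
  exists (last u p); split.
    apply/eqP => pk; have := @walk_uniq k p (rcons p k) ku up.
    rewrite rcons_path up last_rcons /erel jk pk => /(_ isT erefl erefl).
    by move/(congr1 size)/eqP; rewrite size_rcons -[X in X == _]add0n -[_.+1]add1n eqn_add2r.
  move=> i _; split=> [ik|->//].
  have [q uq qi] := reach i.
  have := @walk_uniq k (rcons q k) (rcons p k) ku.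
  rewrite !rcons_path !last_rcons up uq qi /erel jk ik => /(_ isT isT erefl erefl).
  by move/rcons_inj => [qp]; rewrite -qp qi.
have [pa paP] := choice ex_par; exists pa; split=> [k|]; first by have [] := paP k.
apply/setP => -[i k]; apply/idP/imsetP => [ik|[k']].
  have ku : k != u by apply: contraPneq ik => -> /root_in.
  by exists k; rewrite ?inE//; have [_ /(_ i ku) [/(_ ik) ->]] := paP k.
rewrite !inE => ku [-> ->]; by have [_ /(_ (pa k') ku) [_ ->]] := paP k'.
Qed.

Lemma big_parent d (R : comPzRingType) (u : 'I_d) (pa : 'I_d -> 'I_d) (F : 'I_d * 'I_d -> R) :
  \prod_(e in [set (pa k, k) | k in [set~ u]]) F e = \prod_(k | k != u) F (pa k, k).
Proof.
rewrite big_imset /=; last by move=> i j _ _ [].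
by apply: eq_bigl => k; rewrite !inE.
Qed.

(** A walk into [v] must end with the edge from [pa v] and no edge enters [u], so two walks from the
    root to [v] agree when read backwards. *)
Lemma parent_is_root d (u : 'I_d) (pa : 'I_d -> 'I_d) :
  (forall k, exists n, iter n pa k = u) ->
  is_root [set (pa k, k) | k in [set~ u]] u.
Proof.
move=> fin v vu; set E := [set _ | _ in _].
have EP i k : ((i, k) \in E) = (k != u) && (i == pa k).
  apply/imsetP/andP => [[k']|[ku /eqP ->]]; last by exists k; rewrite ?inE.
  by rewrite !inE => ku [-> ->].
have [p [up pv]] : exists p, path (erel E) u p /\ last u p = v.
  have [n] := fin v; elim: n v {vu} => [|n IH] v /=; first by move=> ->; exists [::].
  rewrite -iterS iterSr => /IH [p [up pv]].
  have [->|vu] := eqVneq v u; first by exists [::].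
  exists (rcons p v); rewrite rcons_path up last_rcons /erel EP vu /= pv.
  by rewrite eqxx.
exists p; split => // q [uq qv].
elim/last_ind: p q v up pv uq qv {vu} => [|p x IH] q v; case/lastP: q => [|q y] //=.
- move=> _ uv; rewrite rcons_path last_rcons /erel EP => /andP[_ /andP[+ _]] yv.
  by rewrite yv -uv eqxx.
- by rewrite rcons_path last_rcons /erel EP => /andP[_ /andP[+ _]] xv _ uv; rewrite xv -uv eqxx.
rewrite !rcons_path !last_rcons /erel !EP => /andP[up /andP[_ /eqP px]] xv
  /andP[uq /andP[_ /eqP qy]] yv.
by rewrite xv yv (IH q (pa v))// -?xv// xv -yv.
Qed.

End Arborescence.

(** * Gaussian conditional densities *)

Section Conditional.
Variable R : realType.

Lemma invmx_uniq n (A B : 'M[R]_n) : A *m B = 1%:M -> invmx A = B.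
Proof.
move=> AB; have [uA _] := mulmx1_unit AB.
by rewrite -[LHS]mulmx1 -AB mulKmx.
Qed.

Variables (d : nat) (S : 'M[R]_d).
Hypothesis pS : posdef S.

Lemma posdef_diag_gt0 j : 0 < S j j.
Proof.
have [_ /(_ (delta_mx 0 j))] := pS.
rewrite -rowE trmx_delta -colE !mxE; apply.
by apply/eqP => /matrixP/(_ 0 j)/eqP; rewrite !mxE !eqxx oner_eq0.
Qed.

Definition cond_var j k := S k k - S j k ^+ 2 / S j j.

(** This Schur complement is the quadratic form of [S] at the residual of the regression of
    coordinate [k] on coordinate [j]. *)
Lemma cond_var_gt0 j k : j != k -> 0 < cond_var j k.
Proof.
move=> jk; have [Sym /(_ (delta_mx 0 k - (S j k / S j j) *: delta_mx 0 j))] := pS.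
have Skj : S k j = S j k by rewrite -{1}Sym mxE.
have -> : (delta_mx 0 k - (S j k / S j j) *: delta_mx 0 j : 'rV[R]_d)^T =
    delta_mx k 0 - (S j k / S j j) *: delta_mx j 0.
  by apply/matrixP => a c; rewrite !mxE !(andbC (c == _)).
rewrite !mulmxBl !mulmxBr -!(scalemxAl, scalemxAr).
rewrite -!rowE -!colE !mxE Skj => h.
have -> : cond_var j k = S k k - S j k / S j j * S j k -
  (S j k / S j j * S j k - S j k / S j j * (S j k / S j j * S j j)).
  by rewrite /cond_var; field; rewrite gt_eqF// posdef_diag_gt0.
suff : delta_mx 0 k - S j k / S j j *: delta_mx 0 j != 0 :> 'rV[R]_d.
  by move/h; congr (0 < _); ring.
apply/eqP => /matrixP/(_ 0 k)/eqP; rewrite !mxE !eqxx (eq_sym k) (negbTE jk) /=.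
by rewrite mulr0 subr0 oner_eq0.
Qed.

Lemma gdens_marginal (x : 'rV[R]_d) j : gdens (cov1 S j) (pt1 x j) = ndens (S j j) 0 (x 0 j).
Proof.
have s0 := posdef_diag_gt0 j.
rewrite /gdens /ndens det_mx11 expr1 !mxE; congr (_ * expR _).
have -> : invmx (cov1 S j) = (S j j)^-1%:M.
  apply: invmx_uniq; apply/matrixP => a c; rewrite !ord1 !mxE big_ord1 !mxE.
  by rewrite eqxx mulr1n divff// gt_eqF.
rewrite !big_ord1 !mxE !big_ord1 !mxE eqxx mulr1n.
by field; rewrite gt_eqF.
Qed.

(** The determinant of the 2 by 2 block factors as [S j j * cond_var S j k], and completing the
    square in [x 0 k] splits its quadratic form accordingly. *)
Lemma gdens_conditional (x : 'rV[R]_d) j k : j != k ->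
  gdens (cov2 S j k) (pt2 x j k) / gdens (cov1 S j) (pt1 x j) =
  ndens (cond_var j k) (S j k / S j j * x 0 j) (x 0 k).
Proof.
move=> jk; rewrite gdens_marginal.
have [Sym _] := pS; have Skj : S k j = S j k by rewrite -{1}Sym mxE.
have s0 := posdef_diag_gt0 j; have c0 := cond_var_gt0 jk.
have pp : 0 < pi *+ 2 :> R by rewrite mulrn_wgt0// pi_gt0.
have dE : \det (cov2 S j k) = S j j * cond_var j k.
  rewrite (expand_det_row _ 0) !big_ord_recl big_ord0 /cofactor !det_mx11 !mxE /= Skj /cond_var.
  by rewrite /bump /= !addn0 !addn1; field; exact/lt0r_neq0.
have iE : invmx (cov2 S j k) = (S j j * cond_var j k)^-1 *: 
    \matrix_(a, c) (if a == 0 then if c == 0 then S k k else - S j k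
                    else if c == 0 then - S j k else S j j).
  apply: invmx_uniq; apply/matrixP => a c; rewrite !mxE !big_ord_recl big_ord0 !mxE.
  have D0 : S j j * cond_var j k != 0 by rewrite mulf_neq0 ?gt_eqF.
  have DE : S j j * cond_var j k = S j j * S k k - S j k ^+ 2.
    by rewrite /cond_var; field; exact/lt0r_neq0.
  rewrite DE in D0 *.
  by case: a => -[|[|//]] ? /=; case: c => -[|[|//]] ? /=; rewrite ?Skj ?mulr1n ?mulr0n; field.
rewrite /gdens /ndens dE iE.
have -> : (pi *+ 2) ^+ 2 * (S j j * cond_var j k) = (pi *+ 2 * S j j) * (pi *+ 2 * cond_var j k).
  ring.
rewrite (sqrtrM _ (_ : 0 <= pi *+ 2 * S j j)); last by rewrite mulr_ge0 ?ltW.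
set a := Num.sqrt (_ * S j j); set c := Num.sqrt (_ * cond_var j k).
have a0 : a != 0 by rewrite gt_eqF// sqrtr_gt0 mulr_gt0.
have c0' : c != 0 by rewrite gt_eqF// sqrtr_gt0 mulr_gt0.
set e1 := expR _; set e2 := expR (- (x 0 j - 0) ^+ 2 / _); set e3 := expR _.
suff E : e1 = e2 * e3.
  by rewrite E; field; rewrite a0 c0' gt_eqF// expR_gt0.
rewrite /e1 /e2 /e3 -expRD; congr expR.
rewrite !mxE !big_ord_recl big_ord0 !mxE !big_ord_recl !big_ord0 !mxE /=.
have D0 := lt0r_neq0 c0; have s1 := lt0r_neq0 s0.
have SE : S k k = cond_var j k + S j k ^+ 2 / S j j by rewrite /cond_var subrK.
rewrite SE; field; by rewrite s1 D0.
Qed.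

End Conditional.

(** * The covariance of the two-hub model *)

Section HubCovariance.
Variables (R : realType) (k : nat) (r : R) (b : nat -> bool).

Definition hub_adj : 'M[R]_k.+2 := \matrix_(i, j) ((1 < j)%N && (i == b j.-2 :> nat))%:R.

(** The covariance of [z *m (1%:M + r *: hub_adj)] for a row [z] of independent standard normals. *)
Definition hub_cov : 'M[R]_k.+2 :=
  (1%:M + r *: hub_adj)^T *m (1%:M + r *: hub_adj).

(** A hub has no hub of its own. Hence [1%:M - r *: hub_adj] is an exact inverse, and it recovers
    the noise from the coordinates. *)
Lemma hub_adj_sqr : hub_adj *m hub_adj = 0.
Proof.
apply/matrixP => i j; rewrite !mxE big1// => a _; rewrite !mxE.
case: (ltnP 1 a) => [a1|_] /=; last by rewrite mul0r.
have -> : (a == b j.-2 :> nat) = false.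
  by apply/eqP => ab; move: a1; rewrite ab; case: (b _).
by rewrite andbF mulr0.
Qed.

Lemma hub_adj_inv : (1%:M + r *: hub_adj) *m (1%:M - r *: hub_adj) = 1%:M.
Proof.
rewrite mulmxDl !mulmxBr !mulmx1 mul1mx -scalemxAl -scalemxAr hub_adj_sqr !scaler0.
by rewrite subr0 subrK.
Qed.

Lemma hub_adj_inv' : (1%:M - r *: hub_adj) *m (1%:M + r *: hub_adj) = 1%:M.
Proof. exact: mulmx1C hub_adj_inv. Qed.

Lemma hub_cov_inv : invmx hub_cov = (1%:M - r *: hub_adj) *m (1%:M - r *: hub_adj)^T.
Proof.
apply: invmx_uniq; rewrite /hub_cov mulmxA -[_ *m _ *m (1%:M - _)]mulmxA hub_adj_inv mulmx1.
by rewrite -trmx_mul hub_adj_inv' trmx1.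
Qed.

(** Every leaf has a larger index than its hub, so each factor of [hub_cov] is unitriangular. *)
Lemma det_hub_cov : \det hub_cov = 1.
Proof.
rewrite det_mulmx det_tr.
suff -> : \det (1%:M + r *: hub_adj) = 1 by rewrite mulr1.
rewrite -det_tr det_trig.
  rewrite big1// => i _; rewrite !mxE eqxx.
  have -> : (1 < i)%N && (i == b i.-2 :> nat) = false.
    by apply/negP => /andP[i1 /eqP ib]; move: i1; rewrite ib; case: (b _).
  by rewrite mulr0 addr0.
apply/is_trig_mxP => i j ij; rewrite !mxE.
have -> : (1 < i)%N && (j == b i.-2 :> nat) = false.
  apply/negP => /andP[i1 /eqP jb]; move: (ltn_trans i1 ij); rewrite jb.
  by case: (b _).
by rewrite -val_eqE (gtn_eqF ij) mulr0 addr0.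
Qed.

Lemma posdef_hub_cov : posdef hub_cov.
Proof.
split; first by rewrite /hub_cov trmx_mul trmxK.
move=> x x0; set L := 1%:M + r *: hub_adj.
have -> : x *m hub_cov *m x^T = (x *m L^T) *m (x *m L^T)^T.
  by rewrite /hub_cov trmx_mul trmxK !mulmxA.
have y0 : x *m L^T != 0.
  apply: contraNneq x0 => y0.
  have : x *m L^T *m (1%:M - r *: hub_adj)^T = 0 by rewrite y0 mul0mx.
  by rewrite -mulmxA -trmx_mul hub_adj_inv' trmx1 mulmx1 => ->.
move: (x *m L^T) y0 => y y0; rewrite mxE.
have [j yj] : exists j, y 0 j != 0.
  apply/existsP; rewrite -negb_forall; apply: contraNN y0 => /forallP h.
  by apply/eqP/rowP => j; rewrite mxE; apply/eqP/negbNE/negP => /(elimN idP); rewrite h.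
rewrite (bigD1 j)//= ltr_pwDl//.
  by rewrite mxE -expr2 exprn_even_gt0.
by apply: sumr_ge0 => i _; rewrite mxE -expr2 sqr_ge0.
Qed.

Definition hub_regression (x : 'rV[R]_k.+2) (j : 'I_k.+2) : R :=
  if (1 < j)%N then r * x 0 (inord (b j.-2)) else 0.

Lemma hub_noise x j : (x *m (1%:M - r *: hub_adj)) 0 j = x 0 j - hub_regression x j.
Proof.
rewrite mulmxBr mulmx1 -scalemxAr !mxE /hub_regression; congr (_ - _).
case: ifP => j1; last by rewrite big1 ?mulr0// => i _; rewrite !mxE j1 mulr0.
have bk : (b j.-2 < k.+2)%N by case: (b _).
rewrite (bigD1 (inord (b j.-2)))//= big1 ?addr0 => [|i ib].
  by rewrite !mxE j1 inordK// eqxx mulr1.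
rewrite !mxE j1 /=; case: eqP => [iE|]; last by rewrite mulr0.
by move: ib; rewrite -iE inord_val eqxx.
Qed.

Lemma gdens_hub_cov x : gdens hub_cov x = \prod_j phi (x 0 j - hub_regression x j).
Proof.
rewrite /gdens det_hub_cov mulr1 hub_cov_inv.
have -> : x *m ((1%:M - r *: hub_adj) *m (1%:M - r *: hub_adj)^T) *m x^T =
   (x *m (1%:M - r *: hub_adj)) *m (x *m (1%:M - r *: hub_adj))^T.
  by rewrite trmx_mul !mulmxA.
rewrite mxE (eq_bigr (fun j => (x 0 j - hub_regression x j) ^+ 2)); last first.
  by move=> j _; rewrite -hub_noise expr2; congr (_ * _); rewrite mxE.
rewrite /phi big_split /= big_const_ord -expR_sum.
congr (_ * expR _); last first.
  by rewrite -sumrN mulr_suml.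
have p0 : 0 <= pi *+ 2 :> R by rewrite mulrn_wge0// pi_ge0.
elim: k.+2 => [|n IH] /=; first by rewrite expr0 sqrtr1 invr1.
by rewrite exprS (sqrtrM _ p0) invfM IH.
Qed.

Lemma gdens_hub_cov_seq (s : seq R) :
  gdens hub_cov (vec_of k.+2 s) = hub_dens k r b s.
Proof.
rewrite gdens_hub_cov !big_ord_recl /hub_dens !mulrA /= /hub_regression /=.
rewrite !mxE /= !subr0; congr (_ * _); apply: eq_bigr => i _.
by rewrite !mxE /= inordK//; case: (b _).
Qed.

Lemma hub_covE j a : hub_cov j a =
  (j == a)%:R + r * hub_adj j a + r * hub_adj a j + r ^+ 2 * \sum_i hub_adj i j * hub_adj i a.
Proof.
have -> : hub_cov = 1%:M + r *: hub_adj + r *: hub_adj^T + r ^+ 2 *: (hub_adj^T *m hub_adj).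
  have LT : (1%:M + r *: hub_adj)^T = 1%:M + r *: hub_adj^T.
    by apply/matrixP => i i'; rewrite !mxE eq_sym.
  rewrite /hub_cov LT mulmxDl !mulmxDr !mul1mx mulmx1.
  by rewrite -scalemxAl -scalemxAr scalerA -expr2 addrA.
rewrite !mxE; congr (_ + _ + _ + _ * _).
by apply: eq_bigr => i _; congr (_ * _); rewrite mxE.
Qed.

Lemma hub_adj0 i (j : 'I_k.+2) : (j < 2)%N -> hub_adj i j = 0.
Proof. by rewrite mxE ltnS leqNgt => /negbTE ->. Qed.

Lemma hub_cov_hub (j : 'I_k.+2) a : (j < 2)%N -> hub_cov j a = (j == a)%:R + r * hub_adj j a.
Proof.
move=> j2; rewrite hub_covE (hub_adj0 a j2) big1 => [|i _]; first by rewrite !mulr0 !addr0.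
by rewrite hub_adj0// mul0r.
Qed.

Lemma hub_cov_leaf (j : 'I_k.+2) : (1 < j)%N -> hub_cov j j = 1 + r ^+ 2.
Proof.
move=> j1; rewrite hub_covE eqxx.
have Nj : hub_adj j j = 0.
  by rewrite mxE j1 /=; case: eqP => // jb; move: j1; rewrite jb; case: (b _).
have bk : (b j.-2 < k.+2)%N by case: (b _).
rewrite Nj !mulr0 !addr0; congr (_ + _); rewrite -[RHS]mulr1; congr (_ * _).
rewrite (bigD1 (inord (b j.-2)))//= big1 ?addr0 => [|i ib].
  by rewrite !mxE j1 inordK// eqxx mulr1.
rewrite !mxE j1 /=; case: eqP => [iE|]; last by rewrite mulr0.
by move: ib; rewrite -iE inord_val eqxx.
Qed.

(** A tree has to join the two independent hubs: hub 1 hangs below hub 0 with regression coefficient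
    0, which keeps the model structured for every choice of bits. *)
Definition hub_parent (j : 'I_k.+2) : 'I_k.+2 :=
  if (1 < j)%N then inord (b j.-2) else ord0.

Lemma hub_parent_root : is_root [set (hub_parent j, j) | j in [set~ ord0]] ord0.
Proof.
apply: parent_is_root => j; exists 2; rewrite /= {2}/hub_parent.
case: ifP => _; last by rewrite /hub_parent.
have bk c : (nat_of_bool c < k.+2)%N by case: c.
by rewrite /hub_parent inordK//; case: (b _).
Qed.

Lemma tstructured_hub_cov :
  tstructured [set (hub_parent j, j) | j in [set~ ord0]] hub_cov.
Proof.
exists ord0; split; first exact: hub_parent_root.
have bk c : (nat_of_bool c < k.+2)%N by case: c.
have pS := posdef_hub_cov; move=> x.
rewrite gdens_hub_cov (bigD1 ord0)//= big_parent (gdens_marginal pS).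
rewrite hub_cov_hub// hub_adj0// mulr0 addr0 eqxx -phi_ndens /hub_regression /=.
congr (_ * _); apply: eq_bigr => j j0.
have p2 : (hub_parent j < 2)%N.
  by rewrite /hub_parent; case: ifP => // _; rewrite inordK//; case: (b _).
have pj : hub_parent j != j.
  rewrite /hub_parent; case: ifP => j1; last by rewrite eq_sym.
  by apply/eqP => /(congr1 val); rewrite /= inordK// => jb; move: j1; rewrite -jb; case: (b _).
rewrite (gdens_conditional pS)// /cond_var !(hub_cov_hub _ p2).
rewrite !eqxx (hub_adj0 _ p2) mulr0 addr0 !divr1.
rewrite (negbTE pj) add0r.
have -> : hub_adj (hub_parent j) j = (1 < j)%N%:R.
  by rewrite mxE /hub_parent; case: ifP => //= j1; rewrite inordK// eqxx.
rewrite /hub_regression /hub_parent; case: (ltnP 1 j) => j1.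
  rewrite hub_cov_leaf// phi_ndens mulr1.
  by congr ndens; ring.
have -> : hub_cov j j = 1 by rewrite hub_cov_hub// hub_adj0// eqxx mulr0 addr0.
by rewrite phi_ndens; congr ndens; rewrite ?mulr0 ?mul0r ?expr0n ?subr0.
Qed.

End HubCovariance.

(** * Lower bound on the divergence *)

Section Divergence.
Variable R : realType.

Lemma ln_prodr (I : finType) (F : I -> R) : (forall i, 0 < F i) ->
  ln (\prod_i F i) = \sum_i ln (F i).
Proof.
move=> F0; suff [_ ->] : 0 < \prod_i F i /\ ln (\prod_i F i) = \sum_i ln (F i) by [].
elim/big_rec2: _ => [|i y z _ [z0 zE]]; first by rewrite ltr01 ln1.
by rewrite mulr_gt0// lnM ?posrE// zE.
Qed.

Lemma ndens_gt0 (s m x : R) : 0 < s -> 0 < ndens s m x.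
Proof.
move=> s0; rewrite /ndens mulr_gt0 ?expR_gt0// invr_gt0 sqrtr_gt0 mulr_gt0//.
by rewrite mulrn_wgt0// pi_gt0.
Qed.

Lemma ln_ndens_ratio (s m m' x : R) : 0 < s ->
  ln (ndens 1 m x / ndens s m' x) =
  ln s / 2 + (x - m') ^+ 2 / (s * 2) - (x - m) ^+ 2 / 2.
Proof.
move=> s0; have pp : 0 < pi *+ 2 :> R by rewrite mulrn_wgt0// pi_gt0.
have -> : ndens 1 m x / ndens s m' x =
    Num.sqrt s * expR ((x - m') ^+ 2 / (s * 2) - (x - m) ^+ 2 / 2).
  rewrite expRB /ndens mulr1 mul1r (sqrtrM _ (ltW pp)) !mulNr !expRN.
  field; rewrite !gt_eqF ?expR_gt0 ?sqrtr_gt0//.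
rewrite lnM ?posrE ?expR_gt0 ?sqrtr_gt0// expRK addrA; congr (_ + _ - _).
rewrite -[in RHS](sqr_sqrtr (ltW s0)) expr2 lnM ?posrE ?sqrtr_gt0//.
by field.
Qed.

Lemma ln_ge_half (q : R) : 0 <= q <= 1 -> q / 2 <= ln (1 + q).
Proof.
move=> /andP[q0 q1]; have q2 : 0 < 1 + q by lra.
have := expR_ge1Dx (- ln (1 + q)); rewrite expRN lnK ?posrE//.
move=> h; have : (1 + q)^-1 <= 1 - q / 2.
  by rewrite -[leLHS]mul1r ler_pdivrMr//; nra.
lra.
Qed.

Lemma ln_le_sub1 (a s : R) : 0 < a -> 0 < s -> ln a <= ln s + a / s - 1.
Proof.
move=> a0 s0; have := expR_ge1Dx (ln a - ln s).
rewrite expRB !lnK ?posrE//; lra.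
Qed.

(** With coefficient 0 at the root, the root factor has the same shape as all others, and [pa u] can
    be any other node. *)
Lemma tstructured_dens d (E : dgraph d) (S : 'M[R]_d) : (1 < d)%N ->
  posdef S -> tstructured E S ->
  exists u pa (s beta : 'I_d -> R), [/\ forall j, pa j != j,
    E = [set (pa j, j) | j in [set~ u]], beta u = 0, forall j, 0 < s j &
    forall x, gdens S x = \prod_j ndens (s j) (beta j * x 0 (pa j)) (x 0 j)].
Proof.
move=> d1 pS [u [ru Sx]]; have [pa [paP EE]] := is_root_parent d1 ru.
exists u, pa, (fun j => if j == u then S u u else cond_var S (pa j) j),
  (fun j => if j == u then 0 else S (pa j) j / S (pa j) (pa j)).
split; [exact: paP | exact: EE | by rewrite eqxx | move=> j | move=> x].
  by case: ifP => _; [exact: posdef_diag_gt0 | exact: cond_var_gt0].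
rewrite Sx EE big_parent [RHS](bigD1 u)//= eqxx mul0r gdens_marginal//; congr (_ * _).
by apply: eq_bigr => j /negbTE ->; rewrite gdens_conditional.
Qed.

Variables (k : nat) (r : R) (b : nat -> bool).

Definition hub_coef (c : bool) (j : nat) : R :=
  if (1 < j)%N then r * (b j.-2 == c)%:R else (j == c)%:R.

(** For distinct [j] and [a], the variance of [x_j - beta * x_a] in the two-hub model: the squares
    are the contributions of the two hubs, the last two terms those of the leaf noises. *)
Definition edge_var (j a : nat) (beta : R) : R :=
  (hub_coef false j - beta * hub_coef false a) ^+ 2
  + (hub_coef true j - beta * hub_coef true a) ^+ 2
  + (1 < j)%N%:R + beta ^+ 2 * (1 < a)%N%:R.

Lemma sum_leaf (F : nat -> R) j : (j < k.+2)%N ->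
  \sum_(i < k) F i * (i.+2 == j)%:R = (1 < j)%N%:R * F j.-2.
Proof.
case: j => [|[|j]] jk /=; try by rewrite big1 ?mul0r// => i _; rewrite mulr0.
rewrite (bigD1 (Ordinal (jk : (j < k)%N)))//= eqxx mulr1 mul1r big1 ?addr0//.
move=> i; rewrite -val_eqE /= => ij; case: eqP => [[ij']|]; last by rewrite mulr0.
by rewrite ij' eqxx in ij.
Qed.

Lemma iint_is_edge (j a : 'I_k.+2) beta : a != j ->
  iint_is k.+2 (fun s => hub_dens k r b s * (nth 0 s j - beta * nth 0 s a) ^+ 2)
    (edge_var j a beta).
Proof.
move=> aj; pose w (i : nat) : R := (i == j)%:R - beta * (i == a)%:R.
have := iint_is_hub_dens k r b (w 0) (w 1) (fun i => w i.+2) 0.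
have sumw (F : nat -> R) : \sum_(i < k) w i.+2 * F i =
    (1 < j)%N%:R * F j.-2 - beta * ((1 < a)%N%:R * F a.-2).
  rewrite -!sum_leaf// mulr_sumr -sumrB; apply: eq_bigr => i _.
  by rewrite /w; ring.
have cases (G : nat -> R) (i : nat) : (0 == i)%:R * G 0 + (1 == i)%:R * G 1 +
    (1 < i)%N%:R * G i = G i.
  by case: i => [|[|i]] /=; ring.
have -> : \sum_(i < k) w i.+2 *+ ~~ b i = \sum_(i < k) w i.+2 * (~~ b i)%:R.
  by apply: eq_bigr => i _; rewrite mulr_natr.
have -> : \sum_(i < k) w i.+2 *+ b i = \sum_(i < k) w i.+2 * (b i)%:R.
  by apply: eq_bigr => i _; rewrite mulr_natr.
rewrite (sumw (fun i => (~~ b i)%:R)) (sumw (fun i => (b i)%:R)).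
have -> : \sum_(i < k) w i.+2 ^+ 2 = (1 < j)%N%:R + beta ^+ 2 * (1 < a)%N%:R.
  rewrite -[(1 < j)%N%:R]mulr1 -[(1 < a)%N%:R]mulr1 -!(sum_leaf (fun=> 1))//.
  rewrite mulr_sumr -big_split; apply: eq_bigr => i _ /=; rewrite /w !mul1r.
  have [ij|_] := eqVneq i.+2 (j : nat); last by case: eqP => _ /=; ring.
  by rewrite ij eq_sym val_eqE (negbTE aj) /=; ring.
have -> : (w 0 + r * ((1 < j)%N%:R * (~~ b j.-2)%:R - beta * ((1 < a)%N%:R * (~~ b a.-2)%:R))) ^+ 2
  + (w 1 + r * ((1 < j)%N%:R * (b j.-2)%:R - beta * ((1 < a)%N%:R * (b a.-2)%:R))) ^+ 2 +
  ((1 < j)%N%:R + beta ^+ 2 * (1 < a)%N%:R) + 0 = edge_var j a beta.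
  rewrite addr0 addrA /edge_var; congr (_ ^+ 2 + _ ^+ 2 + _ + _).
    rewrite /w /hub_coef; case: (val j) => [|[|j']]; case: (val a) => [|[|a']] /=;
    rewrite ?eqbF_neg; ring.
  rewrite /w /hub_coef; case: (val j) => [|[|j']]; case: (val a) => [|[|a']] /=;
    rewrite ?eqb_id; ring.
apply: iint_is_ext => s _; congr (_ * _); rewrite addr0; congr (_ ^+ 2).
have := sumw (fun i => nth 0 s i.+2) => ->.
have := cases (nth 0 s) j; have := cases (nth 0 s) a.
have D (i : nat) : (1 < i)%N%:R * nth 0 s i.-2.+2 = (1 < i)%N%:R * nth 0 s i.
  by case: i => [|[|i]] /=; rewrite ?mul0r.
rewrite !D /w => {2}<- {2}<-; ring.
Qed.

Lemma edge_var_self (j a : 'I_k.+2) :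
  (1 < j)%N -> a = b j.-2 :> nat -> edge_var j a r = 1.
Proof.
move=> j1 ->; rewrite /edge_var /hub_coef j1.
by case: (b j.-2) => /=; ring.
Qed.

Lemma edge_var_hub (j a : 'I_k.+2) : (j < 2)%N -> edge_var j a 0 = 1.
Proof.
rewrite /edge_var /hub_coef; case: (val j) => [|[|//]] _ /=; ring.
Qed.

Hypothesis r1 : r ^+ 2 <= 1.

(** The best predictor of a hub is one of its own leaves, with coefficient [r / (1 + r ^+ 2)]; the
    square [s1] vanishes there. *)
Lemma edge_var_hub_ge (j a : 'I_k.+2) beta : a != j -> (j < 2)%N ->
  (1 + r ^+ 2)^-1 <= edge_var j a beta.
Proof.
move=> aj j2; have r0 := sqr_ge0 r; have rp : 0 < 1 + r ^+ 2 by lra.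
rewrite -[leLHS]mul1r ler_pdivrMr//.
have b0 := sqr_ge0 beta; have br := mulr_ge0 b0 r0.
have s1 := sqr_ge0 (beta * (1 + r ^+ 2) - r).
have {aj} : nat_of_ord a != nat_of_ord j by [].
rewrite /edge_var /hub_coef; move: j2.
case: (nat_of_ord j) => [|[|//]] _; case: (nat_of_ord a) => [|[|a']] //= _.
- by nra.
- by case: (b a') => /=; nra.
- by nra.
- by case: (b a') => /=; nra.
Qed.

Lemma edge_var_leaf_ge1 (j a : 'I_k.+2) beta : (1 < j)%N -> 1 <= edge_var j a beta.
Proof.
move=> j1; rewrite /edge_var j1 /=.
set X := _ - _; set Y := _ - _; have := sqr_ge0 X; have := sqr_ge0 Y.
have : 0 <= beta ^+ 2 * (1 < a)%N%:R by rewrite mulr_ge0 ?sqr_ge0.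
lra.
Qed.

(** The critical wrong parent is another leaf of the same hub, where [r ^+ 2 <= 1] bounds the excess
    below by [2 * r ^+ 2 * (beta - 1 / 2) ^+ 2]. The case [beta == 0] covers a leaf that is the root
    of the tree, whose dummy parent may happen to be its hub. *)
Lemma edge_var_leaf_ge (j a : 'I_k.+2) beta : (1 < j)%N ->
  (a != b j.-2 :> nat) || (beta == 0) -> 1 + r ^+ 2 / 2 <= edge_var j a beta.
Proof.
move=> j1; have r0 := sqr_ge0 r; have b0 := sqr_ge0 beta.
have br := mulr_ge0 b0 r0; have s1 := mulr_ge0 r0 (sqr_ge0 (beta - 1 / 2)).
have s2 : 0 <= (1 - r ^+ 2) * beta ^+ 2 by rewrite mulr_ge0// subr_ge0.
rewrite /edge_var /hub_coef j1 => /orP[|/eqP ->]; last first.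
  by case: (b j.-2) => /=; nra.
case: (val a) => [|[|a']]; case: (b j.-2) => //= _; try lra; by case: (b a') => /=; lra.
Qed.

End Divergence.

Lemma KL_hub_cov_wrong (R : realType) (k : nat) (r : R) (b : nat -> bool)
  (E : dgraph k.+2) (S : 'M[R]_k.+2) (eps : R) :
  r ^+ 2 <= 1 -> posdef S -> tstructured E S -> (KL (hub_cov k r b) S <= eps%:E)%E ->
  (\sum_(j < k.+2 | (1 < j)%N) ((hub_parent b j, j) \notin E)%:R) * (r ^+ 2 / 4)
    <= 2 * eps + 2 * r ^+ 2.
Proof.
move=> r1 pS tS.
have [u [pa [s [beta [paP EE bu s0 SE]]]]] := tstructured_dens (isT : (1 < k.+2)%N) pS tS.
have bk c : (nat_of_bool c < k.+2)%N by case: c.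
have r0 := sqr_ge0 r.
(* The true model is put in the same form of parent and coefficient as [S], so that both
   log-densities integrate to values of [edge_var]. A hub gets the other hub with coefficient 0,
   since [iint_is_edge] needs distinct nodes. *)
pose q (j : 'I_k.+2) : 'I_k.+2 :=
  if (1 < j)%N then inord (b j.-2) else if j == ord0 then inord 1 else ord0.
pose gam (j : 'I_k.+2) : R := if (1 < j)%N then r else 0.
have qj j : q j != j.
  rewrite /q; case: ifP => j1.
    by apply/eqP => /(congr1 val); rewrite /= inordK// => jb; move: j1; rewrite -jb; case: (b _).
  by case: ifP => [/eqP ->|/negbT]; [rewrite -val_eqE /= inordK | rewrite eq_sym].
have q1 (j : 'I_k.+2) : edge_var r b j (q j) (gam j) = 1.
  rewrite /gam; case: ifP => j1; first by rewrite edge_var_self// /q j1 inordK.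
  by rewrite edge_var_hub// ltnS leqNgt j1.
(* The mean of [ln_ndens_ratio], coordinate by coordinate. *)
pose v := \sum_j (ln (s j) / 2 * 1 + ((s j * 2)^-1 * edge_var r b j (pa j) (beta j)
   + (- 2^-1) * edge_var r b j (q j) (gam j))).
have -> : KL (hub_cov k r b) S = v%:E.
  apply: (iint_isE (f := fun t => gdens (hub_cov k r b) (vec_of k.+2 t) *
    ln (gdens (hub_cov k r b) (vec_of k.+2 t) / gdens S (vec_of k.+2 t)))).
  apply: iint_is_ext (iint_is_sum _ (fun (j : 'I_k.+2) _ =>
    iint_isD (iint_isZ (ln (s j) / 2) (iint_is_hub_dens1 k r b))
    (iint_isD (iint_isZ (s j * 2)^-1 (iint_is_edge r b (beta j) (paP j)))
       (iint_isZ (- 2^-1) (iint_is_edge r b (gam j) (qj j)))))) => t _.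
  rewrite {2}gdens_hub_cov SE -prodf_div ln_prodr; last first.
    by move=> j; rewrite divr_gt0 ?phi_gt0 ?ndens_gt0.
  rewrite gdens_hub_cov_seq mulr_sumr; apply: eq_bigr => j _.
  rewrite phi_ndens ln_ndens_ratio// !mxE.
  have -> : hub_regression r b (vec_of k.+2 t) j = gam j * nth 0 t (q j).
    by rewrite /hub_regression /gam /q; case: ifP => _; rewrite ?mul0r// !mxE.
  by field; exact: lt0r_neq0.
rewrite lee_fin => veps.
pose c (j : 'I_k.+2) : R := if (1 < j)%N then ((hub_parent b j, j) \notin E)%:R * (r ^+ 2 / 4)
  else - r ^+ 2.
have cE : \sum_j c j = (\sum_(j < k.+2 | (1 < j)%N) ((hub_parent b j, j) \notin E)%:R) *
   (r ^+ 2 / 4) - 2 * r ^+ 2.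
  rewrite (bigID (fun j : 'I_k.+2 => (1 < j)%N)) /= mulr_suml; congr (_ + _).
    by apply: eq_bigr => j j1; rewrite /c j1.
  rewrite (eq_bigr (fun=> - r ^+ 2)) => [|j /negbTE j1]; last by rewrite /c j1.
  by rewrite big_mkcond !big_ord_recl /= big1//; ring.
suff : \sum_j c j <= 2 * v by rewrite cE; lra.
rewrite /v mulr_sumr; apply: ler_sum => j _.
rewrite q1; set V := edge_var _ _ _ _ _.
have key a : 0 < a -> a <= V -> ln a <= 2 * (ln (s j) / 2 * 1 + ((s j * 2)^-1 * V + - 2^-1 * 1)).
  move=> a0 aV; have := ln_le_sub1 (lt_le_trans a0 aV) (s0 j).
  have : ln a <= ln V by rewrite ler_ln ?posrE// (lt_le_trans a0).
  have -> : 2 * (ln (s j) / 2 * 1 + ((s j * 2)^-1 * V + - 2^-1 * 1)) = ln (s j) + V / s j - 1.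
    by field; exact: lt0r_neq0.
  lra.
rewrite /c; case: ifPn => j1; last first.
  have jl : (j < 2)%N by rewrite ltnS leqNgt.
  have rp : 0 < 1 + r ^+ 2 by lra.
  apply: le_trans (key (1 + r ^+ 2)^-1 _ _); last 2 first.
  - by rewrite invr_gt0.
  - exact: edge_var_hub_ge.
  rewrite lnV ?posrE// lerN2; apply: le_ln1Dx; lra.
case: (boolP ((hub_parent b j, j) \in E)) => jE /=.
  rewrite mul0r -[leLHS]ln1; apply: key => //; exact: edge_var_leaf_ge1.
rewrite mul1r; have : 1 + r ^+ 2 / 2 <= V.
  apply: edge_var_leaf_ge => //; apply: contraNT jE; rewrite negb_or negbK => /andP[/eqP paj bj].
  rewrite EE; apply/imsetP; exists j.
    by rewrite !inE; apply: contraNneq bj => ->; rewrite bu.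
  congr (_, _); apply: val_inj; rewrite /= /hub_parent j1 inordK//.
move/key => h; apply: le_trans (h _); last lra.
have := @ln_ge_half R (r ^+ 2 / 2); rewrite (_ : 0 <= _ <= 1); last by apply/andP; split; lra.
by move=> /(_ isT); lra.
Qed.

(** * Assouad's argument *)

Section Assouad.
Variables (R : realType) (k n : nat) (r : R).
Local Notation d := k.+2.
Local Notation T := {ffun 'I_k.+2 -> bool}.

(** Bits are indexed by nodes, so that [flip] takes the node of a leaf; leaf [i] is node [i.+2]. *)
Definition leaf_bits (f : T) (i : nat) : bool := f (inord i.+2).

Definition sample_dens (f : T) (s : seq R) : R :=
  \prod_(i < n) hub_dens k r (leaf_bits f) (take d (drop (i * d) s)).

Definition sample_geomean (f g : T) (s : seq R) : R :=
  \prod_(i < n) hub_geomean k r (leaf_bits f) (leaf_bits g) (take d (drop (i * d) s)).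

Definition flip (j : 'I_k.+2) (f : T) : T := [ffun i => f i (+) (i == j)].

Lemma flipK j : involutive (flip j).
Proof. by move=> f; apply/ffunP => i; rewrite !ffunE addbK. Qed.

Lemma hub_parent_flip (j : 'I_k.+2) f : (1 < j)%N ->
  hub_parent (leaf_bits f) j != hub_parent (leaf_bits (flip j f)) j :> 'I_k.+2.
Proof.
move=> j1; rewrite /hub_parent j1 /leaf_bits; case: j j1 => -[|[|j]]//= jk _.
have -> : inord j.+2 = Ordinal jk :> 'I_k.+2 by apply: val_inj; rewrite /= inordK.
rewrite ffunE eqxx -val_eqE /= !inordK//; by case: (f _).
Qed.

Lemma sample_dens_ge0 f s : 0 <= sample_dens f s.
Proof.
apply: prodr_ge0 => i _; rewrite /hub_dens !mulr_ge0 ?(ltW (phi_gt0 _))//.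
by apply: prodr_ge0 => a _; rewrite ltW// phi_gt0.
Qed.

Lemma sample_geomean_ge0 f g s : 0 <= sample_geomean f g s.
Proof. by apply: prodr_ge0 => i _; exact: hub_geomean_ge0. Qed.

Lemma sample_geomean_sqr (j : 'I_k.+2) f s : (1 < j)%N ->
  sample_geomean f (flip j f) s ^+ 2 = sample_dens f s * sample_dens (flip j f) s.
Proof.
case: j => -[|[|j]]//= jk _; rewrite -prodrXl -big_split /=.
apply: eq_bigr => i _; apply: (@hub_geomeanE R k r _ _ (Ordinal (jk : (j < k)%N))) => a.
rewrite /leaf_bits ffunE -!val_eqE /= inordK ?ltnS// !eqSS.
by case: (f _); case: (a == j :> nat).
Qed.

Lemma iint_is_sample_dens f : iint_is (n * d) (sample_dens f) 1.
Proof. by have := iint_is_prodn n (iint_is_hub_dens1 k r (leaf_bits f)); rewrite expr1n. Qed.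

Lemma bernoulli_ineq (x : R) : 0 <= x <= 1 -> 1 - n%:R * x <= (1 - x) ^+ n.
Proof.
move=> /andP[x0 x1]; elim: n => [|m IH]; first by rewrite mul0r subr0 expr0.
rewrite exprS -[m.+1%:R]natr1; have m0 : 0 <= m%:R :> R by [].
have mx := mulr_ge0 m0 (mulr_ge0 x0 x0).
apply: (@le_trans _ _ ((1 - x) * (1 - m%:R * x))); first by nra.
by rewrite ler_wpM2l// subr_ge0.
Qed.

Hypothesis r1 : r ^+ 2 <= 1.

Lemma iint_is_sample_geomean f g : exists2 v, iint_is (n * d) (sample_geomean f g) v &
  1 - n%:R * (r ^+ 2 / 4) <= v.
Proof.
have r0 := sqr_ge0 r.
have [v iv vr] := iint_is_hub_geomean k (leaf_bits f) (leaf_bits g) r1.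
exists (v ^+ n); first exact: iint_is_prodn.
have r4 : 0 <= r ^+ 2 / 4 <= 1 by apply/andP; split; move: r0 r1; lra.
apply: le_trans (bernoulli_ineq r4) _.
by rewrite lerXn2r ?nnegrE//; move: r0 r1 vr; lra.
Qed.

Lemma sample_densE f s : \prod_(i < n)
  gdens (hub_cov k r (leaf_bits f)) (rowv (tnth (samples_of n d s) i)) = sample_dens f s.
Proof.
apply: eq_bigr => i _; rewrite -gdens_hub_cov_seq; congr gdens.
by apply/rowP => j; rewrite !mxE !tnth_mktuple nth_take// nth_drop.
Qed.

Lemma measurable_block m (i j : nat) :
  measurable_seq m (fun s : seq R => nth 0 (take d (drop (i * d) s)) j).
Proof.
have [jd|dj] := ltnP j d.
  have := @measurable_seq_nth R m (i * d + j); rewrite /measurable_seq => mij.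
  by apply: eq_measurable_fun mij => s _; rewrite nth_take// nth_drop.
have m0 : measurable_fun setT (fun _ : m.-tuple R => 0 : R) by exact: measurable_cst.
apply: eq_measurable_fun m0 => s _; rewrite nth_default// size_take.
by case: ltnP => // h; apply: leq_trans h dj.
Qed.

Lemma measurable_sample_dens f m : measurable_seq m (sample_dens f).
Proof.
apply: measurable_prod => i _; apply: measurable_funM.
  by apply: measurable_funM; apply: (measurableT_comp (@measurable_phi R)); exact: measurable_block.
apply: measurable_prod => a _; apply: (measurableT_comp (@measurable_phi R)).
apply: measurable_funB; first exact: measurable_block.
by apply: measurable_funM => //; exact: measurable_block.
Qed.

Lemma measurable_sample_geomean f g m : measurable_seq m (sample_geomean f g).
Proof.
apply: measurable_prod => i _; apply: measurable_funM.
  apply: measurable_funM.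
    by apply: measurable_funM; apply: (measurableT_comp (@measurable_phi R)); exact: measurable_block.
  apply: measurable_prod => a _; apply: (measurableT_comp (@measurable_phi R)).
  apply: measurable_funB; first exact: measurable_block.
  apply: measurable_funM => //; apply: measurable_funM => //.
  by apply: measurable_funD; exact: measurable_block.
apply: measurableT_comp => //; apply: measurable_funM => //; apply: measurable_funN.
apply: measurable_funM => //; apply: measurable_funX.
by apply: measurable_funB; exact: measurable_block.
Qed.

(* The constants come from [(9 sqrt p - 11 sqrt q) ^ 2 >= 0], applied to both orders. *)
Lemma exclusive_likelihoods (p q m : R) (x y : bool) : 0 <= p -> 0 <= q -> 0 <= m ->
  m ^+ 2 = p * q -> ~~ (x && y) ->
  p * x%:R + q * y%:R <= 121 / 40 * (p + q) - 198 / 40 * m.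
Proof.
move=> p0 q0 m0 mE xy.
have key (a c : R) : 0 <= a -> 0 <= c -> m ^+ 2 = a * c -> 198 * m <= 81 * a + 121 * c.
  move=> a0 c0 mac; rewrite -(ler_pXn2r (_ : 0 < 2)%N) ?nnegrE ?addr_ge0 ?mulr_ge0//.
  by have := sqr_ge0 (81 * a - 121 * c); rewrite exprMn mac; nra.
have k1 := key p q p0 q0 mE; have k2 := key q p q0 p0 (etrans mE (mulrC _ _)).
by case: x xy => /=; case: y => //= _; lra.
Qed.

End Assouad.

Lemma dtree_parent_uniq d (E : dgraph d) (i i' j : 'I_d) : (1 < d)%N -> is_dtree E ->
  i != i' -> ~~ (((i, j) \in E) && ((i', j) \in E)).
Proof.
move=> d1 [u ru] ii'; have [pa [_ ->]] := is_root_parent d1 ru.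
apply/negP => /andP[/imsetP[a _ [ia ja]] /imsetP[a' _ [ia' ja']]].
by rewrite ia ia' -ja -ja' eqxx in ii'.
Qed.

Lemma sum_leaves (R : pzRingType) k (c : R) : \sum_(j < k.+2 | (1 < j)%N) c = k%:R * c.
Proof.
rewrite big_mkcond !big_ord_recl /= !add0r.
by rewrite (eq_bigr (fun=> c))// sumr_const card_ord mulr_natl.
Qed.

(** * Averaging over the bits and the output trees *)

Section AssouadBound.
Variables (R : realType) (k n : nat) (r eps : R).
Local Notation d := k.+2.
Local Notation T := {ffun 'I_k.+2 -> bool}.
Hypothesis r1 : r ^+ 2 <= 1.
Variable A : samples R n d -> dgraph d -> R.
Hypothesis algA : algorithm A.

Local Notation good_for f E := `[< good (hub_cov k r (leaf_bits f)) eps E >].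
Local Notation correct f j E :=
  (((hub_parent (leaf_bits f) j, j) \in E)%:R : R).

Hypothesis good_correct : forall (f : T) E, good_for f E ->
  9 / 10 * k%:R <= \sum_(j < d | (1 < j)%N) correct f j E.

Lemma sum_flip (j : 'I_d) (X : T -> R) :
  \sum_(f : T) X f = 2^-1 * \sum_(f : T) (X f + X (flip j f)).
Proof.
have E : \sum_(f : T) X (flip j f) = \sum_(f : T) X f.
  by rewrite [RHS](reindex_inj (inv_inj (flipK j))).
by rewrite big_split /= E; field.
Qed.

Lemma sum_correct (j : 'I_d) E s : (1 < j)%N -> is_dtree E ->
  \sum_(f : T) sample_dens n r f s * correct f j E <=
  121 / 40 * \sum_(f : T) sample_dens n r f s - 99 / 40 * \sum_(f : T) sample_geomean n r f (flip j f) s.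
Proof.
move=> j1 tE.
have : \sum_(f : T) (sample_dens n r f s * correct f j E +
      sample_dens n r (flip j f) s * correct (flip j f) j E) <=
    \sum_(f : T) (121 / 40 * (sample_dens n r f s + sample_dens n r (flip j f) s)
      - 198 / 40 * sample_geomean n r f (flip j f) s).
  apply: ler_sum => f _; apply: exclusive_likelihoods.
  - exact: sample_dens_ge0.
  - exact: sample_dens_ge0.
  - exact: sample_geomean_ge0.
  - exact: sample_geomean_sqr.
  - by apply: dtree_parent_uniq => //; exact: hub_parent_flip.
rewrite sumrB -!mulr_sumr.
have := sum_flip j (fun f => sample_dens n r f s * correct f j E).
have := sum_flip j (fun f => sample_dens n r f s).
lra.
Qed.

(** The affinity term stands on the left so that only sums of nonnegative functions occur, and the
    inequality can be integrated by monotonicity. *)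
Lemma assouad_pointwise (s : seq R) :
  \sum_(f : T) (9 / 10 * k%:R) * (sample_dens n r f s *
      \sum_(E | good_for f E) A (samples_of n d s) E)
  + 99 / 40 * \sum_(j < d | (1 < j)%N) \sum_(f : T) sample_geomean n r f (flip j f) s
  <= 121 / 40 * k%:R * \sum_(f : T) sample_dens n r f s.
Proof.
have [A0 A1 At _] := algA.
set a := A (samples_of n d s); set P := \sum_(f : T) sample_dens n r f s.
have step (f : T) : (9 / 10 * k%:R) * (sample_dens n r f s * \sum_(E | good_for f E) a E) <=
    \sum_E a E * \sum_(j < d | (1 < j)%N) sample_dens n r f s * correct f j E.
  have -> : (9 / 10 * k%:R) * (sample_dens n r f s * \sum_(E | good_for f E) a E) =
      \sum_(E | good_for f E) a E * (sample_dens n r f s * (9 / 10 * k%:R)).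
    by rewrite -mulr_suml; ring.
  rewrite [leRHS](bigID (fun E => good_for f E)) /= -[leLHS]addr0; apply: lerD.
    apply: ler_sum => E gE; rewrite -mulr_sumr ler_wpM2l ?A0//.
    by apply: ler_wpM2l; [exact: sample_dens_ge0 | exact: good_correct].
  apply: sumr_ge0 => E _; apply: mulr_ge0; first exact: A0.
  by apply: sumr_ge0 => j _; apply: mulr_ge0; rewrite ?sample_dens_ge0.
(* The output probabilities sum to 1, so the terms free of [E] can be spread over the graphs and
   compared one graph at a time; graphs that are not trees have weight 0. *)
have -> : 121 / 40 * k%:R * P = \sum_E a E * (\sum_(j < d | (1 < j)%N) (121 / 40 * P)).
  by rewrite -mulr_suml A1 mul1r sum_leaves; ring.
have -> : 99 / 40 * \sum_(j < d | (1 < j)%N) \sum_(f : T) sample_geomean n r f (flip j f) s =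
   \sum_E a E * (\sum_(j < d | (1 < j)%N) 99 / 40 * \sum_(f : T) sample_geomean n r f (flip j f) s).
  by rewrite -mulr_suml A1 mul1r mulr_sumr.
rewrite -lerBrDr -sumrB.
apply: (le_trans (ler_sum _ (fun f _ => step f))); rewrite exchange_big /=.
apply: ler_sum => E _; rewrite -mulrBr -sumrB -mulr_sumr.
have [tE|tE] := pselect (is_dtree E); last by rewrite /a At// !mul0r.
rewrite ler_wpM2l ?A0// exchange_big /=; apply: ler_sum => j j1.
exact: sum_correct.
Qed.

Lemma assouad_success : (0 < k)%N -> n%:R * (r ^+ 2 / 4) <= 1 / 100 ->
  ~ (forall f : T, ((2 / 3 : R)%:E <= success (hub_cov k r (leaf_bits f)) eps A)%E).
Proof.
move=> k0 nr suc; have [A0 A1 At mA] := algA.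
pose G (f : T) s := sample_dens n r f s * \sum_(E | good_for f E) A (samples_of n d s) E.
have G0 f s : 0 <= G f s.
  by apply: mulr_ge0; [exact: sample_dens_ge0 | apply: sumr_ge0 => E _; exact: A0].
have mG f : measurable_seq (n * d) (fun s => (G f s)%:E).
  apply/measurable_EFinP; apply: measurable_funM; first exact: measurable_sample_dens.
  have m1 : measurable_fun setT (fun s : (n * d).-tuple R =>
      \sum_(E : dgraph d) if good_for f E then A (samples_of n d s) E else 0).
    apply: measurable_sum => E; case: (good_for f E); last exact: measurable_cst.
    exact: (measurableT_comp (mA E) (@measurable_samples_of R n d)).
  by apply: eq_measurable_fun m1 => s _; rewrite [RHS]big_mkcond.
have sG f : success (hub_cov k r (leaf_bits f)) eps A = iint (n * d) (fun s => (G f s)%:E).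
  by rewrite /success; congr iint; apply/funext => s /=; rewrite sample_densE.
pose v (j : 'I_d) (f : T) := s2val (cid2 (iint_is_sample_geomean n r1 f (flip j f))).
pose Q s := 99 / 40 * \sum_(j < d | (1 < j)%N) \sum_(f : T) sample_geomean n r f (flip j f) s.
pose V := 99 / 40 * \sum_(j < d | (1 < j)%N) \sum_(f : T) v j f.
have IQ : iint_is (n * d) Q V.
  apply: iint_isZ; apply: iint_is_sum => j _; apply: iint_is_sum => f _.
  exact: (s2valP (cid2 (iint_is_sample_geomean n r1 f (flip j f)))).
have Vge : 99 / 40 * (k%:R * (#|T|%:R * (99 / 100))) <= V.
  rewrite /V ler_pM2l// -sum_leaves; apply: ler_sum => j _.
  rewrite mulr_natl -sumr_const; apply: ler_sum => f _.
  apply: le_trans (s2valP' (cid2 (iint_is_sample_geomean n r1 f (flip j f)))); lra.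
have IP : iint_is (n * d) (fun s => 121 / 40 * k%:R * \sum_(f : T) sample_dens n r f s)
    (121 / 40 * k%:R * #|T|%:R).
  apply: iint_isZ; rewrite -[#|T|%:R]sumr_const; apply: iint_is_sum => f _.
  exact: iint_is_sample_dens.
have Q0 s : 0 <= Q s.
  by rewrite mulr_ge0//; apply: sumr_ge0 => j _; apply: sumr_ge0 => f _; exact: sample_geomean_ge0.
have mQ : measurable_seq (n * d) (fun s => (Q s)%:E).
  apply/measurable_EFinP; apply: measurable_funM => //.
  have m1 : measurable_fun setT (fun s : (n * d).-tuple R =>
      \sum_(j < d) if (1 < j)%N then \sum_(f : T) sample_geomean n r f (flip j f) s else 0).
    apply: measurable_sum => j; case: (1 < j)%N; last exact: measurable_cst.
    by apply: measurable_sum => f; exact: measurable_sample_geomean.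
  by apply: eq_measurable_fun m1 => s _; rewrite [RHS]big_mkcond.
have mP : measurable_seq (n * d)
    (fun s => (121 / 40 * k%:R * \sum_(f : T) sample_dens n r f s)%:E).
  apply/measurable_EFinP; apply: measurable_funM => //.
  by apply: measurable_sum => f; exact: measurable_sample_dens.
pose c : R := 9 / 10 * k%:R.
have c0 : 0 <= c by rewrite mulr_ge0.
have cG0 f s : (0 <= c%:E * (G f s)%:E)%E by rewrite -EFinM lee_fin mulr_ge0.
have mcG f : measurable_seq (n * d) (fun s => c%:E * (G f s)%:E)%E.
  by apply: emeasurable_funM => //; exact: mG.
have msum : measurable_seq (n * d) (fun s => \sum_(f : T) c%:E * (G f s)%:E)%E.
  by apply: emeasurable_sum => f; exact: mcG.
have sum0 s : (0 <= \sum_(f : T) c%:E * (G f s)%:E)%E by apply: sume_ge0.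
have : (iint (n * d) (fun s => (\sum_(f : T) c%:E * (G f s)%:E) + (Q s)%:E) <=
        iint (n * d) (fun s => (121 / 40 * k%:R * \sum_(f : T) sample_dens n r f s)%:E))%E.
  apply: le_iint => //.
  - by move=> s; rewrite adde_ge0// lee_fin.
  - move=> s; apply: le_trans (_ : _ <= (\sum_(f : T) c * G f s + Q s)%:E)%E _.
      by rewrite EFinD -sumEFin.
    by rewrite lee_fin; exact: assouad_pointwise.
  - by apply: emeasurable_funD.
rewrite iintD//.
rewrite (iint_isE IQ) (iint_isE IP) iint_sum//.
have h1 : ((#|T|%:R * (c * (2 / 3)))%:E <=
    \sum_(f : T) iint (n * d) (fun s => c%:E * (G f s)%:E))%E.
  rewrite mulr_natl -sumr_const -sumEFin; apply: lee_sum => f _.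
  rewrite iintZ//; last by move=> s; rewrite lee_fin.
  by rewrite -sG EFinM; apply: lee_wpmul2l; [rewrite lee_fin | exact: suc].
move=> h2.
have := le_trans (leeD2r V%:E h1) h2; rewrite -EFinD lee_fin.
have kT : 0 < k%:R * #|T|%:R :> R.
  by rewrite mulr_gt0 ?ltr0n//; apply/card_gt0P; exists [ffun=> false].
rewrite /c; set K := k%:R in Vge kT *; set t := #|T|%:R in Vge kT *.
(* In units of [K * t], success everywhere would give [3 / 5 + 9801 / 4000 <= 121 / 40], that is
   [3.05025 <= 3.025]. *)
have -> : t * (9 / 10 * K * (2 / 3)) = 3 / 5 * (K * t) by field.
have -> : 121 / 40 * K * t = 121 / 40 * (K * t) by ring.
move: Vge; have -> : 99 / 40 * (K * (t * (99 / 100))) = 9801 / 4000 * (K * t) by field.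
lra.
Qed.

End AssouadBound.

(** The condition [n = o(d / eps)] takes a stronger quantitative form: a fixed small multiple of
    [d / eps] samples already defeats every algorithm. The hard covariance is one of the two-hub
    family and depends on the algorithm. *)
Theorem theorem4 (R : realType) :
  exists c : R, 0 < c /\
  exists eps0 : R, 0 < eps0 /\
  exists d0 : nat,
  forall (d n : nat) (eps : R),
    (d0 <= d)%N -> 0 < eps -> eps < eps0 ->
    n%:R <= c * d%:R / eps ->
    forall A : samples R n d -> dgraph d -> R, algorithm A ->
      exists S : 'M[R]_d,
        posdef S /\ (exists Tstar : dgraph d, is_dtree Tstar /\ tstructured Tstar S) /\
        (success S eps A < (2 / 3 : R)%:E)%E.
Proof.
(* Since [n * (r ^+ 2 / 4) = 40 * n * eps / d], this constant keeps the affinity loss within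
   [1 / 100]. *)
exists (1 / (40 * 100)); split; first by rewrite divr_gt0// mulr_gt0 ?ltr0Sn.
exists 1; split; first exact: ltr01.
(* With [eps < 1], dimension 200 ensures [r ^+ 2 <= 1]; it also absorbs the loss at the hubs into a
   tenth of the leaves, for which 164 would do. *)
exists 200%N => d n eps d200 e0 e1 nle A algA.
case: d d200 nle A algA => [|[|k]] k200 nle A algA; [by []|by []|].
have dk : 200 <= k.+2%:R :> R by rewrite (ler_nat R 200).
have d0 : 0 < k.+2%:R :> R by rewrite ltr0n.
have kE : k%:R = k.+2%:R - 2 :> R by rewrite -[k.+2]addn2 natrD addrK.
(* With 160, [KL_hub_cov_wrong] leaves at most d / 20 + 8 <= (d - 2) / 10 misattached leaves. *)
pose r := Num.sqrt (160 * eps / k.+2%:R).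
have rE : r ^+ 2 = 160 * eps / k.+2%:R by rewrite sqr_sqrtr// divr_ge0 ?mulr_ge0 ?ltW.
have r1 : r ^+ 2 <= 1 by rewrite rE ler_pdivrMr//; lra.
have r0 : 0 < r ^+ 2 by rewrite rE divr_gt0// mulr_gt0.
have rd : r ^+ 2 * k.+2%:R = 160 * eps by rewrite rE divfK// gt_eqF.
have nr : n%:R * (r ^+ 2 / 4) <= 1 / 100.
  move: nle; rewrite ler_pdivlMr// => nle.
  rewrite -(ler_pM2r d0).
  have -> : n%:R * (r ^+ 2 / 4) * k.+2%:R = n%:R / 4 * (r ^+ 2 * k.+2%:R) by field.
  rewrite rd; lra.
have gc (f : {ffun 'I_k.+2 -> bool}) E : `[< good (hub_cov k r (leaf_bits f)) eps E >] ->
  9 / 10 * k%:R <= \sum_(j < k.+2 | (1 < j)%N) ((hub_parent (leaf_bits f) j, j) \in E)%:R :> R.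
  move=> /asboolP[S' [[pS [tS _]] KLe]].
  have := KL_hub_cov_wrong r1 pS tS KLe.
  set W := \sum_(_ < _ | _) _; set C := \sum_(_ < _ | _) _.
  have : W + C = k%:R.
    rewrite -big_split -[RHS]mulr1 -sum_leaves; apply: eq_bigr => j _ /=.
    by case: (_ \in E); rewrite ?addr0 ?add0r.
  move=> WC h; have : W * r ^+ 2 <= r ^+ 2 * (k.+2%:R / 20 + 8).
    have -> : r ^+ 2 * (k.+2%:R / 20 + 8) = (r ^+ 2 * k.+2%:R) / 20 + 8 * r ^+ 2 by field.
    by rewrite rd; lra.
  rewrite mulrC ler_pM2l// => W2; rewrite kE in WC *; lra.
apply: contrapT => nex.
apply: (@assouad_success R k n r eps r1 A algA gc _ nr) => [|f].
  by rewrite -(ltr0n R) kE; lra.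
rewrite leNgt; apply/negP => sl; apply: nex; exists (hub_cov k r (leaf_bits f)).
split; first exact: posdef_hub_cov; split => //.
exists [set (hub_parent (leaf_bits f) j, j) | j in [set~ ord0]].
by split; [exists ord0; exact: hub_parent_root | exact: tstructured_hub_cov].
Qed.
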